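(* Let $N\ge 3$, let $\Omega\subset\mathbb{R}^N$ be an open domain, $s\in(0,2)$, $2^*(s)=\frac{2(N-s)}{N-2}$, $\kappa\in\mathbb{R}$, $\alpha>1$, $\beta>1$, $\alpha+\beta=2^*(s)$. Then there exists $C=C(\alpha,\beta,\lambda,\mu,\kappa,N,s)>0$ such that for every $(u,v)\in\mathscr{D}(\Omega)$ there holds $$\int_{\Omega}|\nabla u|^2\,dx+\int_{\Omega}|\nabla v|^2\,dx\ \ge\ C\left(\int_{\Omega}\Big(\lambda\frac{|u|^{2^*(s)}}{|x|^s}+\mu\frac{|v|^{2^*(s)}}{|x|^s}+2^*(s)\,\kappa\,\frac{|u|^\alpha|v|^\beta}{|x|^s}\Big)dx\right)^{\frac{2}{2^*(s)}}.$$
   Context: Here $\mathscr{D}(\Omega):=D_0^{1,2}(\Omega)\times D_0^{1,2}(\Omega)$, where $D_0^{1,2}(\Omega)$ is the completion of $C_c^\infty(\Omega)$ with respect to the norm $\|\nabla u\|_{L^2(\Omega)}$. The letters $\lambda,\mu$ denote the real coefficients appearing in the inequality.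
   Formalization: Since λ, μ, κ are arbitrary reals, the weighted integral on the right may be negative (e.g. λ=μ=−1, κ=0), where its power 2/2*(s) is undefined; the integral is replaced by its positive part max(0, ·), which changes nothing when it is nonnegative. *)

(* Defs.v *)
From HB Require Import structures.
From mathcomp Require Import all_boot all_order all_algebra.
From mathcomp Require Import all_classical all_reals all_analysis.
Set Implicit Arguments.
Unset Strict Implicit.
Unset Printing Implicit Defensive.
Import Order.TTheory GRing.Theory Num.Theory.
Import numFieldNormedType.Exports.
Local Open Scope classical_set_scope.
Local Open Scope ring_scope.

Definition rV_display : measure_display -> measure_display.
Proof. exact. Qed.

(* R^n is 'rV[R]_n, with the sigma-algebra generated by the n coordinates
   (the Borel sets), as the library does for n.-tuple R. *)
Section measurable_rV.
Context {R : realType} (n : nat).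

Let coord_rV (i : 'I_n) (x : 'rV[R]_n) : R := x ord0 i.

Let rV_set0 : g_sigma_preimage coord_rV set0.
Proof. exact: sigma_algebra0. Qed.

Let rV_setC A : g_sigma_preimage coord_rV A -> g_sigma_preimage coord_rV (~` A).
Proof. exact: sigma_algebraC. Qed.

Let rV_bigcup (F : _^nat) : (forall i, g_sigma_preimage coord_rV (F i)) ->
  g_sigma_preimage coord_rV (\bigcup_i (F i)).
Proof. exact: sigma_algebra_bigcup. Qed.

HB.instance Definition _ := @isMeasurable.Build
  (rV_display default_measure_display) 'rV[R]_n (g_sigma_preimage coord_rV)
  rV_set0 rV_setC rV_bigcup.

End measurable_rV.

Section lebesgue_rV.
Local Open Scope ereal_scope.
Context {R : realType}.

Definition cons_rV n (p : measurableTypeR R * 'rV[R]_n) : 'rV[R]_n.+1 :=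
  @row_mx R 1 1 n (const_mx p.1) p.2.

Lemma cons_rV0 n p : @cons_rV n p ord0 ord0 = p.1.
Proof.
rewrite /cons_rV (_ : ord0 = lshift n ord0 :> 'I_(1 + n)); last exact/val_inj.
by rewrite [LHS](@row_mxEl R 1 1 n) mxE.
Qed.

Lemma cons_rVS n p (i : 'I_n) : @cons_rV n p ord0 (lift ord0 i) = p.2 ord0 i.
Proof.
rewrite /cons_rV (_ : lift ord0 i = rshift 1 i :> 'I_(1 + n)); last exact/val_inj.
by rewrite [LHS](@row_mxEr R 1 1 n).
Qed.

Lemma cons_rV_surj n (x : 'rV[R]_n.+1) :
  cons_rV (x ord0 ord0, \row_j x ord0 (lift ord0 j)) = x.
Proof.
apply/rowP => i; have [j ->|->] := unliftP ord0 i; last by rewrite cons_rV0.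
by rewrite cons_rVS mxE.
Qed.

Lemma measurable_coord_rV n (i : 'I_n) :
  measurable_fun setT (fun x : 'rV[R]_n => x ord0 i).
Proof.
move=> _ Y mY; rewrite setTI; apply: sub_sigma_algebra => /=.
rewrite -bigcup_seq/=; exists i => /=; first by rewrite mem_index_enum.
by exists Y => //; rewrite setTI.
Qed.

Lemma measurable_rVP d (T : measurableType d) n (f : T -> 'rV[R]_n) :
  (forall i, measurable_fun setT (fun t => f t ord0 i)) ->
  measurable_fun setT f.
Proof.
move=> mf _ Y mY; rewrite setTI.
pose S := [set A : set 'rV[R]_n | measurable (f @^-1` A)].
suff : (@measurable _ 'rV[R]_n) `<=` S by apply.
apply: smallest_sub.
  split.
  - by rewrite /S/= preimage_set0.
  - by move=> A; rewrite /S/= => mA; rewrite setTD preimage_setC; exact: measurableC.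
  - by move=> F mF; rewrite /S/= preimage_bigcup; apply: bigcupT_measurable => k; exact: mF.
case: n => [|n] in f mf Y mY @S *; first by rewrite big_ord0; exact: sub0set.
rewrite -bigcup_mkord_ord; apply: bigcup_sub => i Ii.
move=> A [B mB <-]; rewrite /S/= setTI -[X in measurable X]setTI.
exact: mf.
Qed.

Lemma measurable_cons_rV n : measurable_fun setT (@cons_rV n).
Proof.
apply: measurable_rVP => i; have [j ->|->] := unliftP ord0 i.
  under eq_fun do rewrite cons_rVS.
  apply: (measurableT_comp (measurable_coord_rV j)).
  exact: measurable_snd.
under eq_fun do rewrite cons_rV0.
exact: measurable_fst.
Qed.

Section cons.
Context n (m : {sigma_finite_measure set 'rV[R]_n -> \bar R}).

Definition lebesgue_cons : set 'rV[R]_n.+1 -> \bar R :=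
  pushforward (@lebesgue_measure R \x m) (@cons_rV n).

Let pm := @measure_function_pushforward__canonical__measure_function_Measure
  _ _ _ _ _ (@lebesgue_measure R \x m) (@cons_rV n) (@measurable_cons_rV n).

HB.instance Definition _ := isMeasure.Build _ _ _ lebesgue_cons
  (@measure0 _ _ _ pm) (@measure_ge0 _ _ _ pm)
  (@measure_semi_sigma_additive _ _ _ pm).

Let lebesgue_cons_sigma_finite : sigma_finite setT lebesgue_cons.
Proof.
have /sigma_finiteP[F [TF ndF Foo]] := sigma_finiteT (@lebesgue_measure R).
have /sigma_finiteP[G [TG ndG Goo]] := sigma_finiteT m.
pose tl (x : 'rV[R]_n.+1) : measurableTypeR R * 'rV[R]_n :=
  (x ord0 ord0, \row_j x ord0 (lift ord0 j)).
have tlK p : tl (cons_rV p) = p.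
  case: p => a x; rewrite /tl cons_rV0; congr (_, _).
  by apply/rowP => j; rewrite mxE cons_rVS.
have tl_consK S : @cons_rV n @^-1` (tl @^-1` S) = S.
  by apply/funext => p; rewrite /preimage /mkset tlK.
have mtl : measurable_fun setT tl.
  apply/measurable_fun_pairP; split => /=; first exact: measurable_coord_rV.
  apply: measurable_rVP => i /=; under eq_fun do rewrite mxE.
  exact: measurable_coord_rV.
exists (fun k => tl @^-1` (F k `*` G k)).
  rewrite -preimage_bigcup -[LHS](preimage_setT tl); congr (_ @^-1` _).
  rewrite predeqE => -[x y]; split=> // _.
  have [k _ Fkx] : (\bigcup_k F k) x by rewrite -TF.
  have [l _ Gly] : (\bigcup_k G k) y by rewrite -TG.
  exists (maxn k l) => //; split => /=.
    by move: x Fkx; exact/subsetPset/ndF/leq_maxl.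
  by move: y Gly; exact/subsetPset/ndG/leq_maxr.
move=> k; have [mFk Fkoo] := Foo k; have [mGk Gkoo] := Goo k; split.
  by rewrite -[X in measurable X]setTI; apply: mtl => //; exact: measurableX.
rewrite /lebesgue_cons /pushforward.
by rewrite tl_consK product_measure1E// lte_mul_pinfty// ge0_fin_numE.
Qed.

HB.instance Definition _ := Measure_isSigmaFinite.Build _ _ _ lebesgue_cons
  lebesgue_cons_sigma_finite.

End cons.

(* Lebesgue measure on R^n: the n-fold product of the one-dimensional one. *)
Fixpoint lebesgue_rV n : {sigma_finite_measure set 'rV[R]_n -> \bar R} :=
  match n with
  | 0%N => dirac (0%R : 'rV[R]_0)
  | n'.+1 => lebesgue_cons (lebesgue_rV n')
  end.

Lemma measurable_box n (A : 'I_n -> set R) :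
  (forall i, measurable (A i)) ->
  measurable [set x : 'rV[R]_n | forall i, A i (x ord0 i)].
Proof.
move=> mA; rewrite (_ : [set _ | _] =
  \bigcap_(i in [set: 'I_n]) ((fun x : 'rV[R]_n => x ord0 i) @^-1` A i)).
  apply: fin_bigcap_measurable => // i _.
  by rewrite -[X in measurable X]setTI; apply: measurable_coord_rV.
by apply/seteqP; split=> x /= h => [i _|i]; exact: h.
Qed.

Lemma lebesgue_rV_box n (A : 'I_n -> set R) :
  (forall i, measurable (A i)) ->
  lebesgue_rV n [set x : 'rV[R]_n | forall i, A i (x ord0 i)] =
  (\prod_(i < n) lebesgue_measure (A i)).
Proof.
elim: n A => [|n ih] A mA.
  rewrite big_ord0 [LHS](_ : _ = \d_(0%R : 'rV[R]_0) setT); last first.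
    by congr (_ _); apply/seteqP; split=> x //= _ -[].
  by rewrite diracT.
rewrite big_ord_recl -ih => [|i]; last exact: mA.
rewrite -product_measure1E; [|exact: mA|]; last first.
  by apply: (@measurable_box n (fun i => A (lift ord0 i))) => i; exact: mA.
rewrite [LHS](_ : _ = (lebesgue_measure \x lebesgue_rV n)%E
  (@cons_rV n @^-1` [set x | forall i, A i (x ord0 i)]))//.
congr (_ _); apply/seteqP; split => -[a y] /=.
  move=> h; split => [|i]; first by have := h ord0; rewrite cons_rV0.
  by have := h (lift ord0 i); rewrite cons_rVS.
move=> [ha hy] i; have [j ->|->] := unliftP ord0 i; last by rewrite cons_rV0.
by rewrite cons_rVS; exact: hy.
Qed.

End lebesgue_rV.

Section function_spaces.
Context {R : realType} {N : nat}.
Implicit Types (Omega : set 'rV[R]_N) (f : 'rV[R]_N -> R).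

Definition domain Omega := [/\ open Omega, connected Omega & Omega !=set0].

(* The library norm `|x| on 'rV[R]_N is the sup norm. *)
Definition enorm (x : 'rV[R]_N) : R := Num.sqrt (\sum_i x ord0 i ^+ 2).

Definition evec (i : 'I_N) : 'rV[R]_N := delta_mx ord0 i.

Definition grad f (x : 'rV[R]_N) : 'rV[R]_N := \row_i 'D_(evec i) f x.

Fixpoint Cdiff k f : Prop :=
  continuous f /\
  if k is k'.+1 then
    forall i, (forall x, derivable f x (evec i)) /\ Cdiff k' ('D_(evec i) f)
  else True.

Definition smooth f := forall k, Cdiff k f.

Definition fsupport f := closure [set x | f x != 0].

(* C_c^oo(Omega), its elements being extended by zero to R^N. *)
Definition test_function Omega f :=
  [/\ smooth f, compact (fsupport f) & fsupport f `<=` Omega].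

(* D_0^{1,2}(Omega), the completion of C_c^oo(Omega) for |grad phi|_{L^2}.
   The gradients of a Cauchy sequence phi_n converge in L^2(Omega), and (for
   N >= 3) the classes of Cauchy sequences are identified with functions: a
   subsequence of phi_n converges a.e. to a function that depends, up to null
   sets, only on the class.  An element is thus a function u together with its
   gradient, the a.e. limit of phi_n and the L^2 limit of grad phi_n. *)
Record D012 Omega := MkD012 {
  D012_fun :> 'rV[R]_N -> R ;
  D012_grad : 'rV[R]_N -> 'rV[R]_N ;
  D012_fun_measurable : measurable_fun Omega D012_fun ;
  D012_grad_measurable : measurable_fun Omega D012_grad ;
  D012_approx : exists phi : nat -> 'rV[R]_N -> R,
    [/\ forall n, test_function Omega (phi n),
        (\int[lebesgue_rV N]_(x in Omega)
           (enorm (grad (phi n) x - D012_grad x) ^+ 2)%:E)%E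
          @[n --> \oo] --> 0%E &
        {ae lebesgue_rV N, forall x, Omega x ->
          phi n x @[n --> \oo] --> D012_fun x}] }.

Definition DD Omega : Type := (D012 Omega * D012 Omega)%type.

End function_spaces.

Definition two_star {R : realType} (N : nat) (s : R) : R :=
  2 * (N%:R - s) / (N%:R - 2).

(* Main.v *)
(* The inequality reduces to the scalar Hardy-Sobolev inequality
   [\int |f|^p / |x|^s <= C (\int |grad f|^2)^(p/2)], p = 2^*(s), because
   [|u|^alpha |v|^beta <= |u|^p + |v|^p]. For test functions it follows, through
   Young's inequality with exponents 2/s and 2/(2-s), from Sobolev's inequality
   (s = 0) and Hardy's inequality (s = 2).

   Sobolev: with [gamma = 2(N-1)/(N-2)], [|f|^gamma] is bounded by the integral of
   the absolute value of its i-th partial derivative along every line in the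
   direction i; multiplying over i and using the Loomis-Whitney inequality gives
   the Gagliardo-Nirenberg estimate, whose right-hand side is absorbed after
   Cauchy-Schwarz.

   Hardy: on each line in the direction i, the derivative of
   [f^2 x_i / (|x|^2 + eps)] has integral zero; complete the square and sum over i.

   Both estimates compare functions line by line, so only Tonelli's theorem for
   nonnegative functions is needed. Fatou's lemma passes to D_0^{1,2}. *)
Require Import Defs.
From mathcomp Require Import all_boot all_order all_algebra.
From mathcomp Require Import all_classical all_reals all_analysis.
From mathcomp Require Import measurable_realfun ring lra.
Set Implicit Arguments.
Unset Strict Implicit.
Unset Printing Implicit Defensive.
Import Order.TTheory GRing.Theory Num.Theory.
Import numFieldNormedType.Exports.
Local Open Scope classical_set_scope.
Local Open Scope ring_scope.

(** * Borel sets and Tonelli's theorem *)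

Section measurability.
Context {R : realType} {n : nat}.

(** The sigma-algebra is generated by the coordinates, so the open set is exhausted by boxes with
    rational centres and radii [1/(k+1)], a countable family of measurable sets. *)
Lemma open_measurable_rV (U : set 'rV[R]_n) : open U -> measurable U.
Proof.
move=> oU.
pose box (q : 'rV[rat]_n * nat) :=
  [set x : 'rV[R]_n | forall i, ball (ratr (q.1 ord0 i) : R) (q.2.+1%:R^-1) (x ord0 i)].
rewrite (_ : U = \bigcup_q (if `[< box q `<=` U >] then box q else set0)).
  apply: countable_bigcupT_measurable => [|q]; first exact: countableP.
  case: ifPn => // _; apply: (measurable_box (A := fun i => ball (ratr (q.1 ord0 i) : R) _)) => i.
  exact: measurable_ball.
apply/seteqP; split=> [x Ux|x [q _]]; last first.
  by case: asboolP => // + bx; apply.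
have /nbhs_ballP[e /= e0 eU] : nbhs x U by exact: open_nbhs_nbhs.
(* The radius is below [e / 2]: [x] and any other point of the box are both close to its centre,
   hence within [e] of each other. *)
have [k _ /(_ k (leqnn k)) /= ke] :=
  near_infty_natSinv_lt (PosNum (divr_gt0 e0 (ltr0Sn R 1))).
have k0 : (0 < k.+1%:R^-1 :> R) by rewrite invr_gt0.
set d : R := k.+1%:R^-1 in ke k0.
have qP i : exists q : rat, ball (ratr q : R) d (x ord0 i).
  have : x ord0 i < x ord0 i + d by rewrite ltrDl.
  move=> /rat_in_itvoo[q]; rewrite in_itv/= => /andP[q1 q2]; exists q.
  suff : `|(ratr q : R) - x ord0 i| < d by [].
  by rewrite ltr_norml; apply/andP; split; lra.
have {qP} [q qP] := choice qP.
exists (\row_i q i, k) => //.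
have qx : box (\row_i q i, k) x by move=> i /=; rewrite mxE.
case: asboolP => // -[] y qy; apply: eU.
split => // i j; rewrite !ord1.
have := qx j; have := qy j; rewrite /= mxE.
rewrite /ball/= => h1 h2.
suff : `|x ord0 j - y ord0 j| < e by [].
rewrite (_ : _ - _ = (ratr (q j) - y ord0 j) - (ratr (q j) - x ord0 j)); last by ring.
rewrite (le_lt_trans (ler_normB _ _))// (lt_trans (ltrD h1 h2))//.
rewrite -/d; lra.
Qed.

Lemma continuous_measurable_rV (f : 'rV[R]_n -> R) :
  continuous f -> measurable_fun setT f.
Proof.
move=> cf; apply: (measurability _ (RGenOpens.measurableE R)).
move=> _ [_ [a [b ->] <-]]; rewrite setTI; apply: open_measurable_rV.
by move/continuousP : cf; apply; exact: interval_open.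
Qed.
End measurability.

Section tonelli.
Context {R : realType}.
Local Notation mu1 := (@lebesgue_measure R).
Local Open Scope ereal_scope.

Definition upd n (i : 'I_n) (t : R) (x : 'rV[R]_n) : 'rV[R]_n :=
  \row_j (if j == i then t else x ord0 j).

Lemma upd_cons0 n t a (y : 'rV[R]_n) :
  upd ord0 t (cons_rV (a, y)) = cons_rV (t, y).
Proof.
apply/rowP => j; rewrite mxE; have [k ->|->] := unliftP ord0 j.
  by rewrite !cons_rVS.
by rewrite eqxx cons_rV0.
Qed.

Lemma upd_consS n (i : 'I_n) t a (y : 'rV[R]_n) :
  upd (lift ord0 i) t (cons_rV (a, y)) = cons_rV (a, upd i t y).
Proof.
apply/rowP => j; rewrite mxE; have [k ->|->] := unliftP ord0 j.
  by rewrite !cons_rVS (inj_eq lift_inj) mxE.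
by rewrite !cons_rV0.
Qed.

Lemma measurable_upd n (i : 'I_n) :
  measurable_fun setT (fun p : measurableTypeR R * 'rV[R]_n => upd i p.1 p.2).
Proof.
apply: measurable_rVP => j; under eq_fun do rewrite mxE.
case: (j == i); first exact: measurable_fst.
exact: (measurableT_comp (measurable_coord_rV j) measurable_snd).
Qed.

(** Integration along the line through [x] in direction [i]. The result stays a function of all [n]
    coordinates, constant in the [i]-th, so that marginals in different directions can be
    multiplied. *)
Definition marginal n (i : 'I_n) (f : 'rV[R]_n -> \bar R) (x : 'rV[R]_n) :=
  \int[mu1]_t f (upd i t x).

Lemma marginal_ge0 n i (f : 'rV[R]_n -> \bar R) : (forall x, 0 <= f x) ->
  forall x, 0 <= marginal i f x.
Proof. by move=> f0 x; exact: integral_ge0. Qed.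

Lemma measurable_marginal n i (f : 'rV[R]_n -> \bar R) :
  measurable_fun setT f -> (forall x, 0 <= f x) ->
  measurable_fun setT (marginal i f).
Proof.
move=> mf f0.
apply: (@measurable_fun_fubini_tonelli_G _ _ _ _ _ mu1
  (fun p : measurableTypeR R * 'rV[R]_n => f (upd i p.1 p.2))) => //.
by apply: measurableT_comp => //; exact: measurable_upd.
Qed.

Section cons.
Context n (f : 'rV[R]_n.+1 -> \bar R).
Hypotheses (mf : measurable_fun setT f) (f0 : forall x, 0 <= f x).

Let mfc : measurable_fun setT (f \o @cons_rV R n).
Proof. by apply: measurableT_comp => //; exact: measurable_cons_rV. Qed.

Lemma measurable_cons_slice t : measurable_fun setT (fun y => f (cons_rV (t, y))).
Proof. by apply: (measurableT_comp mfc); exact: pair1_measurable. Qed.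

Lemma measurable_integral_slice :
  measurable_fun setT (fun t : measurableTypeR R =>
    \int[lebesgue_rV n]_y f (cons_rV (t, y))).
Proof.
exact: (measurable_fun_fubini_tonelli_F (m2 := lebesgue_rV n) (f \o @cons_rV R n) mfc (fun=> f0 _)).
Qed.

Lemma measurable_integral_line :
  measurable_fun setT (fun y => \int[mu1]_t f (cons_rV (t, y))).
Proof.
exact: (measurable_fun_fubini_tonelli_G (m1 := mu1) (f \o @cons_rV R n) mfc (fun=> f0 _)).
Qed.

Lemma tonelli_consl :
  \int[lebesgue_rV n.+1]_x f x =
  \int[mu1]_t \int[lebesgue_rV n]_y f (cons_rV (t, y)).
Proof.
rewrite [LHS](ge0_integral_pushforward (@measurable_cons_rV R n))//.
by rewrite preimage_setT (fubini_tonelli1 (m1 := mu1) (m2 := lebesgue_rV n) _ mfc (fun=> f0 _)).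
Qed.

Lemma tonelli_consr :
  \int[lebesgue_rV n.+1]_x f x =
  \int[lebesgue_rV n]_y \int[mu1]_t f (cons_rV (t, y)).
Proof.
rewrite [LHS](ge0_integral_pushforward (@measurable_cons_rV R n))//.
by rewrite preimage_setT (fubini_tonelli2 (m1 := mu1) (m2 := lebesgue_rV n) _ mfc (fun=> f0 _)).
Qed.
End cons.

(** Induction on the dimension. Tonelli makes direction 0 the inner integral; any other direction
    lies within the slices on which the first coordinate is fixed. *)
Lemma le_integral_marginal n i (f g : 'rV[R]_n -> \bar R) :
  measurable_fun setT f -> measurable_fun setT g ->
  (forall x, 0 <= f x) -> (forall x, 0 <= g x) ->
  (forall x, marginal i f x <= marginal i g x) ->
  \int[lebesgue_rV n]_x f x <= \int[lebesgue_rV n]_x g x.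
Proof.
elim: n i f g => [[]//|n ih i f g mf mg f0 g0 fg].
have [j ij|i0] := unliftP ord0 i.
  rewrite !tonelli_consl//; apply: ge0_le_integral => //=.
  - by move=> t _; exact: integral_ge0.
  - exact: measurable_integral_slice.
  - exact: measurable_integral_slice.
  - move=> t _; apply: (ih j _ _ (measurable_cons_slice mf t) (measurable_cons_slice mg t)) => // y.
    have := fg (cons_rV (t, y)).
    by rewrite /marginal ij; under eq_integral do rewrite upd_consS;
      under [leRHS]eq_integral do rewrite upd_consS.
rewrite !tonelli_consr//; apply: ge0_le_integral => //=.
- by move=> t _; exact: integral_ge0.
- exact: measurable_integral_line.
- exact: measurable_integral_line.
(* The marginal in direction 0 ignores the first coordinate, so the value [0] is arbitrary. *)
- move=> y _; have := fg (cons_rV (0%R, y)).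
  by rewrite /marginal i0; under eq_integral do rewrite upd_cons0;
      under [leRHS]eq_integral do rewrite upd_cons0.
Qed.

End tonelli.

(** * The Loomis-Whitney inequality *)

Lemma powR_prod {R : realType} (I : Type) (r : seq I) (b : I -> R) (p : R) :
  (forall i, 0 <= b i) ->
  (\prod_(i <- r) b i) `^ p = \prod_(i <- r) (b i `^ p).
Proof.
move=> b0; elim: r => [|i r ih]; first by rewrite !big_nil powR1.
by rewrite !big_cons powRM ?ih// prodr_ge0.
Qed.

Lemma AGM_powR {R : realType} n (b : 'I_n.+1 -> R) : (forall i, 0 <= b i) ->
  \prod_(i < n.+1) (b i `^ n.+1%:R^-1) <= (\sum_(i < n.+1) b i) / n.+1%:R.
Proof.
move=> b0; rewrite -powR_prod//.
have [+ _] := @leif_AGM R 'I_n.+1 predT b (fun i _ => b0 i).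
rewrite cardT size_enum_ord => h.
have s0 : 0 <= (\sum_(i < n.+1) b i) / n.+1%:R by rewrite divr_ge0// sumr_ge0.
set m := (X in _ <= X); apply: (@le_trans _ _ ((m ^+ n.+1) `^ n.+1%:R^-1)).
  by rewrite ge0_ler_powR// ?nnegrE ?prodr_ge0 ?exprn_ge0.
by rewrite -powR_mulrn// -powRrM mulfV// powRr1.
Qed.

Section ereal_prod.
Local Open Scope ereal_scope.

Lemma prode_gt0 {R : realDomainType} (I : Type) (r : seq I) (P : pred I) (f : I -> \bar R) :
  (forall i, P i -> 0 < f i) -> 0 < \prod_(i <- r | P i) f i.
Proof. by move=> f0; elim/big_ind : _ => //; exact: mule_gt0. Qed.

Lemma poweR_prod {R : realType} (I : Type) (r : seq I) (b : I -> \bar R) (p : R) :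
  (forall i, 0 <= b i) ->
  (\prod_(i <- r) b i) `^ p = \prod_(i <- r) (b i `^ p).
Proof.
move=> b0; elim: r => [|i r ih]; first by rewrite !big_nil poweR1r.
by rewrite !big_cons poweRM ?ih// prode_ge0.
Qed.

Lemma emeasurable_prod {R : realType} d (T : measurableType d) (I : Type) (r : seq I)
    (f : I -> T -> \bar R) : (forall i, measurable_fun setT (f i)) ->
  measurable_fun setT (fun x => \prod_(i <- r) f i x).
Proof.
move=> mf; elim: r => [|i r ih]; first by under eq_fun do rewrite big_nil; exact: measurable_cst.
by under eq_fun do rewrite big_cons; exact: emeasurable_funM.
Qed.

Section hoelder.
Context d (T : measurableType d) {R : realType} (mu : {measure set T -> \bar R}).

(* Uniform weights: an exponent k/n is obtained by repeating a factor k times. *)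
Lemma hoelder_prod n (G : 'I_n.+1 -> T -> \bar R) :
  (forall i, measurable_fun setT (G i)) -> (forall i x, 0 <= G i x) ->
  \int[mu]_x \prod_(i < n.+1) (G i x `^ n.+1%:R^-1) <=
  \prod_(i < n.+1) (\int[mu]_x G i x) `^ n.+1%:R^-1.
Proof.
move=> mG G0; set p : R := n.+1%:R^-1%R.
have p0 : (0 < p)%R by rewrite invr_gt0.
have pn0 : p != 0%R by rewrite gt_eqF.
have P0 x : 0 <= \prod_(i < n.+1) (G i x `^ p).
  by apply: prode_ge0 => i _; exact: poweR_ge0.
have mP : measurable_fun setT (fun x => \prod_(i < n.+1) (G i x `^ p)).
  apply: emeasurable_prod => i.
  exact: (measurableT_comp (measurable_poweR p) (mG i)).
(* A zero integral makes [G i] vanish almost everywhere, and the product with it. Excluding this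
   first keeps the case of an infinite integral free of products [0 * +oo]. *)
have [[i Gi0]|nG0] := pselect (exists i, \int[mu]_x G i x = 0).
  rewrite [leLHS](_ : _ = 0); first by apply: prode_ge0 => j _; exact: poweR_ge0.
  have : ae_eq mu setT (G i) (cst 0).
    apply/(ae_eq_integral_abs mu measurableT (mG i)).
    by rewrite -[RHS]Gi0; apply: eq_integral => x _; rewrite gee0_abs.
  move=> h; rewrite -[RHS](integral0 mu setT).
  apply: ge0_ae_eq_integral => //.
  apply: filterS h => x /(_ I) Gix _.
  by rewrite (bigD1 i)//= Gix poweR0r// mul0e.
have IG0 i : 0 < \int[mu]_x G i x.
  rewrite lt0e integral_ge0// andbT; apply/eqP => h.
  by apply: nG0; exists i.
have [[i Giy]|nGy] := pselect (exists i, \int[mu]_x G i x = +oo).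
  rewrite [leRHS](_ : _ = +oo) ?leey//.
  rewrite (bigD1 i)//= Giy poweRyr// gt0_mulye// prode_gt0// => j _.
  exact: poweR_gt0.
pose a i := fine (\int[mu]_x G i x).
have aE i : \int[mu]_x G i x = (a i)%:E.
  rewrite fineK// ge0_fin_numE ?integral_ge0// ltey; apply/eqP => h.
  by apply: nGy; exists i.
have a0 i : (0 < a i)%R by rewrite -lte_fin -aE.
pose c : R := (\prod_(i < n.+1) (a i `^ p))%R.
have c0 : (0 < c)%R by apply: prodr_gt0 => i _; exact: powR_gt0.
(* Normalize each factor by its integral and apply the arithmetic-geometric mean inequality
   pointwise. Every [G i / a i] has integral 1, so their mean does too, and the constant [c]
   remains. *)
apply: (@le_trans _ _ (\int[mu]_x
    ((c * p)%:E * \sum_(i < n.+1) ((a i)^-1%:E * G i x)))).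
  apply: ge0_le_integral => //.
    apply: emeasurable_funM => //; apply: emeasurable_sum => i.
    exact: emeasurable_funM.
  move=> x _; have [[i Gixy]|nGxy] := pselect (exists i, G i x = +oo).
    rewrite [leRHS](_ : _ = +oo) ?leey//.
    rewrite [X in _ * X](_ : _ = +oo).
      by rewrite mulry gtr0_sg ?mul1e// mulr_gt0.
    apply/esum_eqyP => [j _|].
      by rewrite gt_eqF// (lt_le_trans _ (mule_ge0 _ (G0 j x)))// lee_fin invr_ge0 ltW.
    exists i; split; rewrite ?mem_index_enum//.
    by rewrite Gixy mulry gtr0_sg ?mul1e// invr_gt0.
  pose g i := fine (G i x).
  have gE i : G i x = (g i)%:E.
    rewrite fineK// ge0_fin_numE// ltey; apply/eqP => h.
    by apply: nGxy; exists i.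
  have g0 i : (0 <= g i)%R by rewrite -lee_fin -gE.
  under eq_bigr do rewrite gE poweR_EFin.
  under [X in _ <= _ * X]eq_bigr do rewrite gE -EFinM.
  rewrite prodEFin sumEFin -EFinM lee_fin.
  rewrite [leLHS](_ : _ = c * \prod_(i < n.+1) ((a i)^-1 * g i) `^ p)%R; last first.
    rewrite -big_split/=; apply: eq_bigr => i _.
    rewrite -powRM ?(ltW (a0 _)) ?mulr_ge0 ?invr_ge0 ?(ltW (a0 _))//.
    by rewrite mulrA mulfV ?mul1r// gt_eqF.
  rewrite -mulrA ler_pM2l// [leRHS]mulrC; apply: AGM_powR => i.
  by rewrite mulr_ge0// invr_ge0 ltW.
have cp0 : (0 <= c * p)%R by rewrite ltW// mulr_gt0.
have ai0 i : (0 <= (a i)^-1)%R by rewrite invr_ge0 ltW.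
rewrite ge0_integralZl_EFin//; last 2 first.
- by move=> x _; apply: sume_ge0 => i _; rewrite mule_ge0// lee_fin.
- by apply: emeasurable_sum => i; exact: emeasurable_funM.
rewrite ge0_integral_sum//; last 2 first.
- by move=> i; exact: emeasurable_funM.
- by move=> i x _; rewrite mule_ge0// lee_fin.
under eq_bigr do rewrite ge0_integralZl_EFin// aE -EFinM.
under [leRHS]eq_bigr do rewrite aE poweR_EFin.
rewrite sumEFin prodEFin -EFinM lee_fin -/c -mulrA ler_piMr ?(ltW c0)//.
rewrite (eq_bigr (fun=> 1%R)); last by move=> i _; rewrite mulVf// gt_eqF.
by rewrite sumr_const card_ord mulVf.
Qed.

End hoelder.
End ereal_prod.

Section loomis_whitney.
Context {R : realType}.
Local Open Scope ereal_scope.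
Implicit Types n : nat.

Lemma lee_prod (I : Type) (r : seq I) (P : pred I) (a b : I -> \bar R) :
  (forall i, P i -> 0 <= a i) -> (forall i, P i -> a i <= b i) ->
  \prod_(i <- r | P i) a i <= \prod_(i <- r | P i) b i.
Proof.
move=> a0 ab; suff : 0 <= \prod_(i <- r | P i) a i <= \prod_(i <- r | P i) b i.
  by case/andP.
elim/big_ind2 : _ => [|x1 x2 y1 y2 /andP[x0 xy] /andP[y0 yy]|i Pi].
- by rewrite lexx lee01.
- by rewrite mule_ge0// lee_pmul.
- by rewrite a0// ab.
Qed.

Lemma poweR_prod_const n (y : \bar R) : 0 <= y ->
  \prod_(j < n.+1) (y `^ n.+1%:R^-1) = y.
Proof.
case: y => [r| |//] r0.
  under eq_bigr do rewrite poweR_EFin.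
  rewrite prodEFin prodr_const card_ord -powR_mulrn ?powR_ge0// -powRrM.
  by rewrite mulVf// powRr1.
by rewrite big_ord_recl poweRyr ?invr_eq0// gt0_mulye// prode_gt0.
Qed.

Lemma marginal_cons0 n (f : 'rV[R]_n.+1 -> \bar R) t y :
  marginal ord0 f (cons_rV (t, y)) = \int[lebesgue_measure]_a f (cons_rV (a, y)).
Proof. by apply: eq_integral => a _; rewrite upd_cons0. Qed.

Lemma marginal_consS n (i : 'I_n) (f : 'rV[R]_n.+1 -> \bar R) t y :
  marginal (lift ord0 i) f (cons_rV (t, y)) = marginal i (fun z => f (cons_rV (t, z))) y.
Proof. by apply: eq_integral => a _; rewrite upd_consS. Qed.

(** ['rV[R]_0] is a single point carrying a Dirac mass, so the only line in ['rV[R]_1] is the whole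
    space. *)
Lemma marginal_rV1 (f : 'rV[R]_1 -> \bar R) x :
  measurable_fun setT f -> (forall x, 0 <= f x) ->
  marginal ord0 f x = \int[lebesgue_rV 1]_z f z.
Proof.
move=> mf f0; rewrite tonelli_consr// integral_dirac//; last first.
  exact: measurable_integral_line.
rewrite diracT mul1e -(cons_rV_surj x) marginal_cons0.
by apply: eq_integral => a _; congr (f (cons_rV (a, _))); apply/rowP => -[].
Qed.

Let mpoweR d (T : measurableType d) (f : T -> \bar R) p :
  measurable_fun setT f -> measurable_fun setT (fun x => f x `^ p).
Proof. by move=> mf; exact: (measurableT_comp (measurable_poweR p) mf). Qed.

(* Induction on the dimension: slicing along the first coordinate derives [LW n]
   from [LWQ n], and Hoelder's inequality derives [LWQ n.+1] from [LW n]. *)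
Let LWQ n := forall (g : 'rV[R]_n.+1 -> \bar R) (f : 'I_n.+1 -> 'rV[R]_n.+1 -> \bar R),
  measurable_fun setT g -> (forall x, 0 <= g x) ->
  (forall i, measurable_fun setT (f i)) -> (forall i x, 0 <= f i x) ->
  \int[lebesgue_rV n.+1]_x
    (g x `^ n.+1%:R^-1 * \prod_(i < n.+1) marginal i (f i) x `^ n.+1%:R^-1) <=
  (\int[lebesgue_rV n.+1]_x g x) `^ n.+1%:R^-1 *
    \prod_(i < n.+1) (\int[lebesgue_rV n.+1]_x f i x) `^ n.+1%:R^-1.

Let LW n := forall f : 'I_n.+2 -> 'rV[R]_n.+2 -> \bar R,
  (forall i, measurable_fun setT (f i)) -> (forall i x, 0 <= f i x) ->
  \int[lebesgue_rV n.+2]_x (\prod_(i < n.+2) marginal i (f i) x `^ n.+1%:R^-1) <=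
  \prod_(i < n.+2) (\int[lebesgue_rV n.+2]_x f i x) `^ n.+1%:R^-1.

(** In dimension one the marginal is a constant and leaves the integral. *)
Let LWQ0 : LWQ 0.
Proof.
move=> g f mg g0 mf f0; rewrite invr1.
have -> : \int[lebesgue_rV 1]_x (g x `^ 1 * \prod_(i < 1) marginal i (f i) x `^ 1) =
    \int[lebesgue_rV 1]_x (g x * \int[lebesgue_rV 1]_z f ord0 z).
  apply: eq_integral => x _; rewrite big_ord_recl big_ord0 mule1 !poweRe1//.
    by rewrite marginal_rV1.
  exact: marginal_ge0.
rewrite ge0_integralZr//; last exact: integral_ge0.
by rewrite big_ord_recl big_ord0 mule1 !poweRe1//; exact: integral_ge0.
Qed.

Let LWQ_LW n : LWQ n -> LW n.
Proof.
move=> Q f mf f0; set p : R := n.+1%:R^-1%R.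
have mM i : measurable_fun setT (marginal i (f i)) by exact: measurable_marginal.
rewrite tonelli_consl//; last 2 first.
- by apply: emeasurable_prod => i; exact: mpoweR.
- by move=> x; apply: prode_ge0 => i _; exact: poweR_ge0.
have mF i : measurable_fun setT
    (fun t : measurableTypeR R => \int[lebesgue_rV n.+1]_y f i (cons_rV (t, y))).
  exact: measurable_integral_slice.
(* The marginal in direction 0 is the same on every slice and takes the part of [g] in [LWQ n]; its
   integral over a slice is the full integral of [f ord0]. *)
apply: (@le_trans _ _ (\int[lebesgue_measure]_t
   ((\int[lebesgue_rV n.+2]_x f ord0 x) `^ p *
    \prod_(i < n.+1) (\int[lebesgue_rV n.+1]_y f (lift ord0 i) (cons_rV (t, y))) `^ p))).
  apply: ge0_le_integral => //=.
  - move=> t _; apply: integral_ge0 => y _.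
    by apply: prode_ge0 => i _; exact: poweR_ge0.
  - apply: (measurable_integral_slice
      (f := fun x => \prod_(i < n.+2) marginal i (f i) x `^ p)).
      by apply: emeasurable_prod => i; exact: mpoweR.
    by move=> x; apply: prode_ge0 => i _; exact: poweR_ge0.
  - apply: emeasurable_funM => //; apply: emeasurable_prod => i; exact: mpoweR.
  - move=> t _; under eq_integral do rewrite big_ord_recl marginal_cons0.
    under eq_integral do under eq_bigr do rewrite marginal_consS.
    rewrite [\int[_]_x f ord0 x]tonelli_consr//.
    apply: (Q (fun y => \int[lebesgue_measure]_a f ord0 (cons_rV (a, y)))
              (fun i z => f (lift ord0 i) (cons_rV (t, z)))) => //.
    + exact: measurable_integral_line.
    + by move=> y; exact: integral_ge0.
    + by move=> i; exact: measurable_cons_slice.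
rewrite ge0_integralZl//; last 3 first.
- apply: emeasurable_prod => i; exact: mpoweR.
- by move=> t _; apply: prode_ge0 => i _; exact: poweR_ge0.
- exact: poweR_ge0.
rewrite big_ord_recl lee_pmul//.
- exact: poweR_ge0.
- by apply: integral_ge0 => t _; apply: prode_ge0 => i _; exact: poweR_ge0.
under [leRHS]eq_bigr do rewrite tonelli_consl//.
(* Hoelder's inequality in [t], with [n.+1] equal weights: the slice integrals of the remaining
   functions integrate to their full integrals. *)
apply: (@hoelder_prod _ _ _ lebesgue_measure _ (fun i (t : measurableTypeR R) =>
  \int[lebesgue_rV n.+1]_y f (lift ord0 i) (cons_rV (t, y)))) => //.
by move=> i t; exact: integral_ge0.
Qed.

Let LW_LWQ n : LW n -> LWQ n.+1.
Proof.
move=> L g f mg g0 mf f0; set q : R := n.+2%:R^-1%R.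
pose p : R := n.+1%:R^-1%R.
have powE (a : 'I_n.+2 -> \bar R) : (forall i, 0 <= a i) ->
    \prod_(j < n.+1) (\prod_(i < n.+2) a i `^ p) `^ q = \prod_(i < n.+2) a i `^ q.
  move=> a0; rewrite poweR_prod; last by move=> i; exact: poweR_ge0.
  rewrite exchange_big/=; apply: eq_bigr => i _.
  by under eq_bigr do rewrite poweRAC; rewrite poweR_prod_const// poweR_ge0.
have M0 i x : 0 <= marginal i (f i) x by exact: marginal_ge0.
pose H x := \prod_(i < n.+2) marginal i (f i) x `^ p.
have mH : measurable_fun setT H.
  by apply: emeasurable_prod => i; apply: mpoweR; exact: measurable_marginal.
have H0 x : 0 <= H x by apply: prode_ge0 => i _; exact: poweR_ge0.
(* Hoelder's inequality with [n.+2] equal weights, [g] taken once and [H] repeated [n.+1] times.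
   This gives [H] the exponent [(n+1)/(n+2)], which turns the exponents [1/(n+1)] of the marginals
   into [1/(n+2)]; [LW n] bounds the integral of [H]. *)
pose G (j : 'I_n.+2) := if j == ord0 then g else H.
have -> : \int[lebesgue_rV n.+2]_x
      (g x `^ q * \prod_(i < n.+2) marginal i (f i) x `^ q) =
    \int[lebesgue_rV n.+2]_x \prod_(j < n.+2) G j x `^ q.
  by apply: eq_integral => x _; rewrite [RHS]big_ord_recl /= powE.
apply: (le_trans (hoelder_prod (lebesgue_rV n.+2) _ _)).
- by move=> i; rewrite /G; case: ifP.
- by move=> i x; rewrite /G; case: ifP.
rewrite [leLHS]big_ord_recl /=; apply: lee_pmul => //; first exact: poweR_ge0.
  by apply: prode_ge0 => i _; exact: poweR_ge0.
rewrite -powE; last by move=> i; exact: integral_ge0.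
apply: lee_prod => j _; first exact: poweR_ge0.
apply: gt0_ler_poweR; rewrite ?invr_ge0 ?in_itv/= ?leey ?andbT//.
- exact: integral_ge0.
- by apply: prode_ge0 => i _; exact: poweR_ge0.
- exact: L.
Qed.

Theorem loomis_whitney n (f : 'I_n.+2 -> 'rV[R]_n.+2 -> \bar R) :
  (forall i, measurable_fun setT (f i)) -> (forall i x, 0 <= f i x) ->
  \int[lebesgue_rV n.+2]_x (\prod_(i < n.+2) marginal i (f i) x `^ n.+1%:R^-1) <=
  \prod_(i < n.+2) (\int[lebesgue_rV n.+2]_x f i x) `^ n.+1%:R^-1.
Proof. move: f; rewrite -/(LW n); by apply: LWQ_LW; elim: n => // n /LWQ_LW/LW_LWQ. Qed.

End loomis_whitney.

(** * Functions of one variable *)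

Section line.
Context {R : realType}.
Local Notation mu1 := (@lebesgue_measure R).
Implicit Types g P Q : R -> R.

Lemma FTC_is_derive g (g' : R -> R) (a b : R) : a < b -> continuous g' ->
  (forall t : R, is_derive t 1 g (g' t)) ->
  (\int[mu1]_(t in `[a, b]) (g' t)%:E = (g b - g a)%:E)%E.
Proof.
move=> ab cg' dg.
have cg : continuous g.
  by move=> t; apply/differentiable_continuous/derivable1_diffP.
rewrite (continuous_FTC2 (F := g) ab) ?EFinB//.
- exact: continuous_subspaceT.
- split=> [t _||]; first by [].
  + exact/cvg_at_right_filter/cg.
  + exact/cvg_at_left_filter/cg.
- by move=> t _; rewrite derive1E derive_val.
Qed.

(** Fundamental theorem of calculus on [[a, x]], where [a] lies to the left of [x] and so far out
    that [g a = 0]. *)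
Lemma le_norm_integral_derive g (g' : R -> R) (K x : R) : continuous g' ->
  (forall t : R, is_derive t 1 g (g' t)) -> (forall t, K <= `|t| -> g t = 0) ->
  (`|g x|%:E <= \int[mu1]_t `|g' t|%:E)%E.
Proof.
move=> cg' dg gK; pose a := - (`|K| + `|x| + 1).
have ax : a < x.
  by rewrite /a ltrNl; have := normr_ge0 K; have := ler_norm (- x); rewrite normrN; lra.
have ga : g a = 0.
  apply: gK; rewrite /a normrN ger0_norm; last by rewrite !addr_ge0.
  by rewrite -addrA ler_wpDr// ler_norm.
have := FTC_is_derive ax cg' dg; rewrite ga subr0 => gx.
have mg' : measurable_fun setT (EFin \o g').
  by apply/measurable_EFinP; exact: continuous_measurable_fun.
rewrite -abse_EFin -gx.
apply: (le_trans (le_abse_integral mu1 _ _)) => //.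
  exact: measurable_funTS.
apply: ge0_subset_integral => //.
by apply/measurable_EFinP; apply: measurableT_comp => //; exact: continuous_measurable_fun.
Qed.

(** The derivative of a compactly supported [g] integrates to zero, so it can be added to [Q] for
    free. Signed integrals are confined to [[-b, b]], where continuity gives integrability; going
    back to the whole line on the right uses [0 <= Q]. *)
Lemma le_integral_derive g (g' : R -> R) P Q (K : R) :
  continuous g' -> continuous P -> continuous Q ->
  (forall t : R, is_derive t 1 g (g' t)) -> (forall t, K <= `|t| -> g t = 0) ->
  (forall t, K <= `|t| -> P t = 0) -> (forall t, 0 <= Q t) ->
  (forall t, P t <= Q t + g' t) ->
  (\int[mu1]_t (P t)%:E <= \int[mu1]_t (Q t)%:E)%E.
Proof.
move=> cg' cP cQ dg gK PK Q0 PQ; pose b : R := `|K| + 1.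
pose D := `[- b, b]%classic.
have b0 : 0 < b by rewrite /b; have := normr_ge0 K; lra.
have nb : - b < b by lra.
have mD : measurable D by exact: measurable_itv.
have Kb t : ~ D t -> K <= `|t|.
  rewrite /D /= => h; rewrite leNgt; apply/negP => tK; apply: h; rewrite in_itv/= -ler_norml.
  by rewrite /b (le_trans (ltW tK))// (le_trans (ler_norm K))// lerDl.
have int f : continuous f -> mu1.-integrable D (EFin \o f).
  move=> cf; apply: continuous_compact_integrable; first exact: segment_compact.
  exact: continuous_subspaceT.
have -> : (\int[mu1]_t (P t)%:E = \int[mu1]_(t in D) (P t)%:E)%E.
  rewrite [RHS]integral_mkcond; apply: eq_integral => t _.
  rewrite patchE; case: ifPn => // /negP tb; rewrite PK//; apply: Kb => h.
  by apply: tb; rewrite inE.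
apply: (@le_trans _ _ (\int[mu1]_(t in D) ((EFin \o Q) t + (EFin \o g') t))%E).
  apply: le_integral => //; first exact: (int P cP).
    by apply: integrableD => //; [exact: (int Q cQ)|exact: (int g' cg')].
  by move=> t _; rewrite -EFinD lee_fin.
rewrite integralD//; [|exact: (int Q cQ)|exact: (int g' cg')].
rewrite [X in (_ + X)%E](FTC_is_derive nb cg' dg).
rewrite !gK ?subr0 ?adde0//.
- apply: ge0_subset_integral => //; last by move=> t _; rewrite lee_fin.
  by apply/measurable_EFinP; exact: continuous_measurable_fun.
- by rewrite normrN gtr0_norm// /b (le_trans (ler_norm K))// lerDl.
- by rewrite gtr0_norm// /b (le_trans (ler_norm K))// lerDl.
Qed.

Lemma continuous_powR_norm p : 0 < p -> continuous (fun u : R => `|u| `^ p).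
Proof.
move=> p0 u; have [->|u0] := eqVneq u 0.
  rewrite /continuous_at normr0 powR0 ?gt_eqF//; apply/cvgr0Pnorm_lt => e e0.
  near=> v; rewrite ger0_norm ?powR_ge0//.
  have -> : e = (e `^ p^-1) `^ p by rewrite -powRrM mulVf ?gt_eqF// powRr1// ltW.
  apply: gt0_ltr_powR; rewrite // ?nnegrE ?powR_ge0//.
  near: v; apply: cvgr0_norm_lt; last exact: powR_gt0.
  exact: cvg_id.
apply: (@continuous_comp _ _ _ (fun u : R => `|u|) (fun v => v `^ p)).
  exact: norm_continuous.
apply/differentiable_continuous/derivable1_diffP.
have nu0 : 0 < `|u| by rewrite normr_gt0.
by have := is_derive1_powR p nu0.
Unshelve. all: by end_near. Qed.

Lemma is_derive_powR_norm p (u : R) : 2 <= p ->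
  is_derive u 1 (fun v : R => `|v| `^ p) (p * (`|u| `^ (p - 2) * u)).
Proof.
move=> p2; have pB (x : R) : 0 < x -> x `^ (p - 1) = x `^ (p - 2) * x.
  move=> x0; rewrite (_ : p - 1 = p - 2 + 1); last by ring.
  by rewrite powRD ?powRr1 ?ltW// (gt_eqF x0) implybT.
have [u0|u0|->] := ltgtP u 0.
- have nu0 : 0 < - u by rewrite oppr_gt0.
  have h : is_derive u 1 ((fun v : R => v `^ p) \o -%R) (p * (- u) `^ (p - 1) * -1).
    by apply: is_derive1_comp; exact: is_derive1_powR.
  apply: near_eq_is_derive (is_derive_eq h _).
    near=> v; rewrite /= ltr0_norm//.
    near: v; exact: lt_nbhsl.
  by rewrite ltr0_norm// pB//; ring.
- apply: near_eq_is_derive (is_derive_eq (is_derive1_powR p u0) _).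
    near=> v; rewrite gtr0_norm//.
    near: v; exact: lt_nbhsr.
  by rewrite gtr0_norm// pB.
- rewrite mulr0 mulr0.
  (* At the origin the difference quotient is at most [|h|] in absolute value once [|h| < 1],
     because then [|h|^p <= |h|^2]. *)
  have c0 : h^-1 *: (((fun v : R => `|v| `^ p) \o shift 0) (h *: (1 : R)) - `|0 : R| `^ p)
      @[h --> (0 : R)^'] --> (0 : R).
    apply/cvgr0Pnorm_lt => e e0; near=> h.
    have h0 : h != 0 by near: h; exact: nbhs_dnbhs_neq.
    have h1 : `|h| < Num.min 1 e.
      near: h; apply: dnbhs0_lt; rewrite lt_min ltr01//.
    have [h1' he] : `|h| < 1 /\ `|h| < e by move: h1; rewrite lt_min => /andP[].
    rewrite /= normr0 powR0 ?gt_eqF ?(lt_le_trans _ p2)// subr0 addr0.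
    rewrite /GRing.scale/= mulr1 normrM normfV (ger0_norm (powR_ge0 _ _)).
    rewrite (le_lt_trans _ he)// mulrC ler_pdivrMr ?normr_gt0//.
    rewrite -expr2 -powR_mulrn// ger_powR// normr_gt0 h0 ltW//.
  by apply: DeriveDef; [apply/cvg_ex; exists 0 | exact: cvg_lim c0].
Unshelve. all: by end_near. Qed.

End line.

(** * Compactly supported functions and Sobolev's inequality *)

Section C1c.
Context {R : realType} {n : nat}.
Implicit Types (f : 'rV[R]_n -> R) (x : 'rV[R]_n).

(** Regularity is stated through partial derivatives along the axes, as the estimates are made on
    lines parallel to them; compact support is vanishing for large sup norm. *)
Definition C1c f := [/\ continuous f, forall i x, derivable f x (evec i),
  forall i, continuous ('D_(evec i) f) &
  exists K : R, forall x, K <= `|x| -> f x = 0].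

Lemma norm_coord_le x i : `|x ord0 i| <= `|x|.
Proof.
have -> : `|x| = \big[Num.max/0]_ij `|x ij.1 ij.2| by exact: mx_normrE.
exact: (le_bigmax _ (fun ij : 'I_1 * 'I_n => `|x ij.1 ij.2|) (ord0, i)).
Qed.

Lemma norm_upd_ge i t x : `|t| <= `|upd i t x|.
Proof. by have := norm_coord_le (upd i t x) i; rewrite mxE eqxx. Qed.

Lemma upd_id i x : upd i (x ord0 i) x = x.
Proof. by apply/rowP => j; rewrite mxE; case: eqP => [->|]. Qed.

Lemma upd_add i (h t : R) x : upd i (h + t) x = h *: evec i + upd i t x.
Proof.
apply/rowP => j; rewrite !mxE eqxx/=.
by case: eqP => _; rewrite ?mulr1// mulr0 add0r.
Qed.

Lemma continuous_upd i x : continuous (fun t : R => upd i t x).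
Proof.
have -> : (fun t : R => upd i t x) = (fun t : R => t *: evec i + upd i 0 x).
  by apply/funext => t; rewrite -upd_add addr0.
move=> t; apply: cvgD; last exact: cvg_cst.
by apply: cvgZr_tmp; exact: cvg_id.
Qed.

Lemma is_derive_line f i (t : R) x : (forall x, derivable f x (evec i)) ->
  is_derive t 1 (fun t : R => f (upd i t x)) ('D_(evec i) f (upd i t x)).
Proof.
move=> df.
have E : (fun h : R => h^-1 *:
           (((fun t : R => f (upd i t x)) \o shift t) (h *: 1) - f (upd i t x))) =
         (fun h : R => h^-1 *: ((f \o shift (upd i t x)) (h *: evec i) - f (upd i t x))).
  apply/funext => h /=; have -> : h *: (1 : R) = h by rewrite /GRing.scale/= mulr1.
  by rewrite upd_add.
apply: DeriveDef; last by rewrite /derive E.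
by rewrite /derivable E; exact: df.
Qed.

Lemma compact_supp_bounded f K : continuous f -> (forall x, K <= `|x| -> f x = 0) ->
  exists2 B, 0 <= B & forall x, `|f x| <= B.
Proof.
move=> cf fK.
have : compact (f @` closed_ball (0 : 'rV[R]_n) (`|K| + 1)).
  apply: continuous_compact; first exact: continuous_subspaceT.
  refine (@bounded_closed_compact R n _ _ _); last exact: closed_ball_closed.
  exists (`|K| + 1); split; first exact: num_real.
  move=> M KM x /=; rewrite closed_ballE; last by rewrite ltr_wpDl.
  by rewrite /closed_ball_/= sub0r normrN => /le_trans; apply; exact: ltW.
move=> /compact_bounded[M [_ /(_ (`|M| + 1))]].
rewrite (le_lt_trans (ler_norm M)) ?ltrDl// => /(_ isT) fB.
exists (`|M| + 1); first by rewrite addr_ge0.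
move=> x; have [xK|Kx] := ltP `|x| K.
  apply: fB; exists x => //.
  rewrite closed_ballE; last by rewrite ltr_wpDl.
  rewrite /closed_ball_/= sub0r normrN (le_trans (ltW xK))//.
  by rewrite (le_trans (ler_norm K))// lerDl.
by rewrite fK// normr0 addr_ge0.
Qed.

(** The support lies in a cube [[-b, b]^n], which has finite Lebesgue measure. *)
Lemma compact_supp_integral_lty (f : 'rV[R]_n -> R) (K B : R) :
  measurable_fun setT f -> (forall x, K <= `|x| -> f x = 0) ->
  (forall x, 0 <= f x <= B) ->
  (\int[lebesgue_rV n]_x (f x)%:E < +oo)%E.
Proof.
move=> mf fK fB; pose b := `|K| + 1.
have b0 : 0 < b by rewrite ltr_wpDl.
pose I := `[- b, b]%classic.
pose D := [set x : 'rV[R]_n | forall i, I (x ord0 i)].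
have mD : measurable D.
  by apply: (@measurable_box R n (fun=> I)) => i; exact: measurable_itv.
have -> : (\int[lebesgue_rV n]_x (f x)%:E = \int[lebesgue_rV n]_(x in D) (f x)%:E)%E.
  rewrite [RHS]integral_mkcond; apply: eq_integral => x _.
  rewrite patchE; case: ifPn => // /negP xD; rewrite fK// leNgt; apply/negP => xK.
  apply: xD; rewrite inE => i; rewrite /I/= in_itv/= -ler_norml.
  rewrite (le_trans (norm_coord_le _ _))// (le_trans (ltW xK))//.
  by rewrite (le_trans (ler_norm K))// lerDl.
apply: (@le_lt_trans _ _ (\int[lebesgue_rV n]_(x in D) B%:E)%E).
  apply: ge0_le_integral => //.
  - by move=> x _; rewrite lee_fin; case/andP: (fB x).
  - by apply: measurable_funTS; apply/measurable_EFinP.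
  - by move=> x _; rewrite lee_fin; case/andP: (fB x).
have B0 : 0 <= B by case/andP: (fB 0) => /le_trans; apply.
rewrite integral_cst//= lte_mul_pinfty//.
rewrite (@lebesgue_rV_box R n (fun=> I)); last by move=> i; exact: measurable_itv.
rewrite ltey_eq prode_fin_num// => i _.
by rewrite lebesgue_measure_itv/= lte_fin; case: ifP.
Qed.

Lemma derive_supp f K i x : (forall x, K <= `|x| -> f x = 0) -> K < `|x| ->
  'D_(evec i) f x = 0.
Proof.
move=> fK Kx.
have : is_derive x (evec i) f 0.
  apply: near_eq_is_derive (is_derive_cst (0 : R) x (evec i)).
  near=> y; rewrite fK//.
  by near: y; apply: (cvgr_norm_ge x) => //; exact: cvg_id.
by move=> ?; rewrite derive_val.
Unshelve. all: by end_near. Qed.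

End C1c.

Section C1c_integrals.
Context {R : realType} {n : nat} (f : 'rV[R]_n -> R).
Hypothesis Cf : C1c f.

Let mf : measurable_fun setT f.
Proof. by case: Cf => cf _ _ _; exact: continuous_measurable_rV. Qed.

Let mDf i : measurable_fun setT ('D_(evec i) f).
Proof. by case: Cf => _ _ cDf _; exact: continuous_measurable_rV. Qed.

Lemma measurable_C1c_powR p : measurable_fun setT (fun x => (`|f x| `^ p)%:E).
Proof.
by apply/measurable_EFinP; apply: (measurableT_comp (measurable_powR p)); exact: measurableT_comp.
Qed.

Lemma measurable_C1c_deriv_sqr i :
  measurable_fun setT (fun x => ('D_(evec i) f x ^+ 2)%:E).
Proof. by apply/measurable_EFinP; exact: measurable_funX. Qed.

Lemma C1c_powR_lty p : 0 < p ->
  (\int[lebesgue_rV n]_x (`|f x| `^ p)%:E < +oo)%E.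
Proof.
move=> p0; have [cf _ _ [K fK]] := Cf.
have [B B0 fB] := compact_supp_bounded cf fK.
apply: (@compact_supp_integral_lty _ _ _ K (B `^ p)).
- by apply/measurable_EFinP; exact: measurable_C1c_powR.
- by move=> x Kx; rewrite fK// normr0 powR0// gt_eqF.
- by move=> x; rewrite powR_ge0/= ge0_ler_powR ?nnegrE// ltW.
Qed.

Lemma C1c_deriv_sqr_lty i :
  (\int[lebesgue_rV n]_x ('D_(evec i) f x ^+ 2)%:E < +oo)%E.
Proof.
have [cf _ cDf [K fK]] := Cf.
(* The derivative is known to vanish where [K < |x|], strictly, hence the margin 1. *)
have DK x : K + 1 <= `|x| -> 'D_(evec i) f x = 0.
  by move=> Kx; apply: derive_supp fK _; rewrite (lt_le_trans _ Kx)// ltrDl.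
have [B B0 fB] := compact_supp_bounded (cDf i) DK.
apply: (@compact_supp_integral_lty _ _ _ (K + 1) (B ^+ 2)).
- by apply/measurable_EFinP; exact: measurable_C1c_deriv_sqr.
- by move=> x Kx; rewrite DK// expr0n.
- by move=> x; rewrite sqr_ge0/= -(real_normK (num_real _)) lerXn2r ?nnegrE.
Qed.

(** The start of the Gagliardo-Nirenberg argument: on the line through [x] in direction [i], the
    function [|f|^p] is continuously differentiable since [p > 2], and is bounded by the integral of
    the modulus of its derivative. *)
Lemma powR_norm_le_marginal (p : R) i x : 2 < p ->
  ((`|f x| `^ p)%:E <=
   marginal i (fun x => `|p * (`|f x| `^ (p - 2) * f x) * 'D_(evec i) f x|%:E) x)%E.
Proof.
move=> p2; have [cf df cDf [K fK]] := Cf.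
have p0 : 0 < p by rewrite (lt_trans _ p2).
have cl (g : 'rV[R]_n -> R) : continuous g -> continuous (fun t : R => g (upd i t x)).
  move=> cg t; apply: (@continuous_comp _ _ _ (fun t : R => upd i t x) g); last exact: cg.
  exact: continuous_upd.
pose G (t : R) := `|f (upd i t x)| `^ p.
have GE : `|f x| `^ p = `|G (x ord0 i)| by rewrite /G upd_id [RHS](ger0_norm (powR_ge0 _ _)).
rewrite GE; apply: (@le_norm_integral_derive R G (fun t => p *
  (`|f (upd i t x)| `^ (p - 2) * f (upd i t x)) * 'D_(evec i) f (upd i t x)) K _ _ _ _).
- move=> t; apply: cvgM; last exact: (cl _ (cDf i)).
  apply: cvgM; first exact: cvg_cst.
  apply: cvgM; last exact: (cl _ cf).
  apply: (@continuous_comp _ _ _ (fun t : R => f (upd i t x)) (fun u => `|u| `^ (p - 2))).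
    apply: (cl (fun x => f x) cf).
  by apply: continuous_powR_norm; rewrite subr_gt0.
- move=> t; apply: (@is_derive1_comp _ (fun v => `|v| `^ p) (fun t => f (upd i t x))).
    exact/is_derive_powR_norm/ltW.
  exact: is_derive_line.
- move=> t Kt; rewrite /G fK ?normr0 ?powR0 ?gt_eqF//.
  exact: le_trans Kt (norm_upd_ge _ _ _).
Qed.

End C1c_integrals.

Section sobolev.
Context {R : realType} (n : nat).
(** As [N - 2 = n.+1] and [N - 1 = n.+2], [q] is the Sobolev exponent [2N/(N-2)]. The choice of
    [gam] gives [gam N/(N-1) = q], for the Loomis-Whitney inequality, and [gam - 1 = q/2], for the
    Cauchy-Schwarz inequality. *)
Let N := n.+3.
Let q : R := 2 * N%:R / n.+1%:R.
Let gam : R := 2 * n.+2%:R / n.+1%:R.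

Let gam2 : 2 < gam.
Proof. by rewrite /gam ltr_pdivlMr// ltr_pM2l// ltr_nat. Qed.

Let n1 : n.+1%:R != 0 :> R. Proof. by []. Qed.
Let n2 : n.+2%:R != 0 :> R. Proof. by []. Qed.

Let n2E : n.+2%:R = n.+1%:R + 1 :> R. Proof. by rewrite natr1. Qed.
Let n3E : n.+3%:R = n.+1%:R + 2 :> R. Proof. by rewrite -addn2 natrD. Qed.

Let gamq : gam - 1 = q / 2.
Proof. by rewrite /gam /q /N n2E n3E; field. Qed.

Let gampq : gam * n.+2%:R^-1 * N%:R = q.
Proof. by rewrite /gam /q /N n2E n3E; field; rewrite nat1r -n2E n1 n2. Qed.

Let gam0 : 0 < gam. Proof. by rewrite (lt_trans _ gam2). Qed.

Let q0 : 0 < q. Proof. by rewrite /q divr_gt0// mulr_gt0. Qed.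

(* The exponent N/(2(N-1)) of [s] on the right is < 1, so [s] can be absorbed on the left. *)
Let absorb (s d : R) : 0 <= s -> 0 < d ->
  s <= ((gam * (s * d) `^ 2^-1) `^ n.+2%:R^-1) ^+ N ->
  s <= gam `^ q * d `^ (N%:R / n.+1%:R).
Proof.
move=> s0 d0; have [->|sn0] := eqVneq s 0; first by move=> _; rewrite mulr_ge0 ?powR_ge0.
have {sn0}s0 : 0 < s by rewrite lt_neqAle eq_sym sn0.
(* [e] is the exponent of [s] on the right. Dividing by [s^e] leaves [s^(1-e)], and raising to the
   power [gam = 1/(1-e)] restores [s]. *)
pose e : R := n.+2%:R^-1 * N%:R / 2.
have e1 : (1 - e) * gam = 1 by rewrite /e /gam /N n2E n3E; field; rewrite nat1r -n2E n1 n2.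
have e2 : e * gam = N%:R / n.+1%:R by rewrite /e /gam /N n2E n3E; field; rewrite nat1r -n2E n1 n2.
have sd0 : 0 < s * d by rewrite mulr_gt0.
rewrite -powR_mulrn ?powR_ge0// -powRrM powRM ?powR_ge0 ?(ltW gam0)// -[_ `^ _ `^ _]powRrM.
rewrite (_ : 2^-1 * (n.+2%:R^-1 * N%:R) = e); last by rewrite /e mulrC.
rewrite (powRM _ (ltW s0) (ltW d0)) => h.
have {}h : s `^ (1 - e) <= gam `^ (n.+2%:R^-1 * N%:R) * d `^ e.
  rewrite -(ler_pM2l (powR_gt0 e s0)) -powRD; last by rewrite (gt_eqF s0) implybT.
  by rewrite addrC subrK powRr1 ?(ltW s0)// mulrCA.
have := ge0_ler_powR (ltW gam0) _ _ h.
rewrite -powRrM e1 powRr1 ?(ltW s0)// => h2; apply: (le_trans (h2 _ _)).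
- by rewrite nnegrE powR_ge0.
- by rewrite nnegrE mulr_ge0 ?powR_ge0.
rewrite le_eqVlt; apply/orP; left; apply/eqP.
rewrite powRM ?powR_ge0// -!powRrM e2; congr (_ `^ _ * _).
by rewrite -gampq; ring.
Qed.

Lemma sobolev (f : 'rV[R]_N -> R) (d : R) : C1c f -> 0 < d ->
  (forall i, (\int[lebesgue_rV N]_x ('D_(evec i) f x ^+ 2)%:E <= d%:E)%E) ->
  (\int[lebesgue_rV N]_x (`|f x| `^ q)%:E <= (gam `^ q * d `^ (N%:R / n.+1%:R))%:E)%E.
Proof.
move=> Cf d0 Dd.
pose p : R := n.+2%:R^-1.
have p0 : 0 < p by rewrite invr_gt0.
pose F i x := `|gam * (`|f x| `^ (gam - 2) * f x) * 'D_(evec i) f x|%:E.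
(* The two factors of Cauchy-Schwarz: [F i] is [gam] times the product of their square roots,
   because [gam - 1 = q/2]. *)
pose G i (j : 'I_2) x := if (j : nat) == 0%N then (`|f x| `^ q)%:E else ('D_(evec i) f x ^+ 2)%:E.
have mG i j : measurable_fun setT (G i j).
  by rewrite /G; case: eqP => _; [exact: measurable_C1c_powR|exact: measurable_C1c_deriv_sqr].
have G0 i j x : (0 <= G i j x)%E.
  by rewrite /G; case: eqP => _; rewrite lee_fin ?powR_ge0 ?sqr_ge0.
have FE i x : F i x = (gam%:E * \prod_(j < 2) (G i j x `^ 2^-1))%E.
  rewrite !big_ord_recl big_ord0 mule1 /G/= -!EFinM; congr (_%:E).
  rewrite -powRrM -gamq -(real_normK (num_real ('D_(evec i) f x))).
  rewrite -powR_mulrn// -[_ `^ 2 `^ _]powRrM mulfV// powRr1//.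
  have -> : `|f x| `^ (gam - 1) = `|f x| * `|f x| `^ (gam - 2).
    rewrite (_ : gam - 2 = gam - 1 - 1); last by ring.
    by rewrite mulr_powRB1// subr_gt0 (lt_trans _ gam2)// ltr1n.
  by rewrite normrM normrM (normrM _ (f x)) (gtr0_norm gam0) (ger0_norm (powR_ge0 _ _)); ring.
have mP i : measurable_fun setT (fun x => \prod_(j < 2) (G i j x `^ 2^-1))%E.
  apply: emeasurable_prod => j.
  exact: (measurableT_comp (measurable_poweR _) (mG i j)).
have mF i : measurable_fun setT (F i).
  rewrite (_ : F i = fun x => gam%:E * \prod_(j < 2) (G i j x `^ 2^-1))%E; last first.
    by apply/funext => x; exact: FE.
  exact: emeasurable_funM.
have F0 i x : (0 <= F i x)%E by rewrite lee_fin.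
pose S := (\int[lebesgue_rV N]_x (`|f x| `^ q)%:E)%E.
have S0 : (0 <= S)%E by apply: integral_ge0 => x _; rewrite lee_fin powR_ge0.
pose s := fine S.
(* [S] is finite by compact support, which allows it to be absorbed. *)
have SE : S = s%:E by rewrite fineK// ge0_fin_numE// C1c_powR_lty.
have s0 : 0 <= s by rewrite -lee_fin -SE.
have IF i : (\int[lebesgue_rV N]_x F i x <= (gam * (s * d) `^ 2^-1)%:E)%E.
  under eq_integral do rewrite FE.
  rewrite ge0_integralZl_EFin//; last 2 first.
  - by move=> x _; apply: prode_ge0 => j _; exact: poweR_ge0.
  - exact: ltW.
  rewrite [leRHS]EFinM lee_pmul2l// ?lte_fin//.
  apply: (le_trans (hoelder_prod (lebesgue_rV N) (mG i) (G0 i))).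
  rewrite !big_ord_recl big_ord0 mule1 /G/= -/S SE poweR_EFin.
  rewrite (powRM _ s0 (ltW d0)) EFinM lee_pmul ?lee_fin ?powR_ge0 ?poweR_ge0//.
  rewrite -poweR_EFin gt0_ler_poweR ?invr_ge0 ?in_itv/= ?leey ?andbT ?lee_fin ?(ltW d0)//.
  by apply: integral_ge0 => x _; rewrite lee_fin sqr_ge0.
suff : (S <= (((gam * (s * d) `^ 2^-1) `^ n.+2%:R^-1) ^+ N)%:E)%E.
  by rewrite -/S SE !lee_fin; exact: absorb.
apply: (@le_trans _ _ (\int[lebesgue_rV N]_x (\prod_(i < N) marginal i (F i) x `^ p))%E).
  apply: ge0_le_integral => //.
  - exact: measurable_C1c_powR.
  - apply: emeasurable_prod => i.
    apply: (measurableT_comp (measurable_poweR _)); exact: measurable_marginal.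
  move=> x _.
  (* [|f|^q] is split into [N] equal factors [(|f|^gam)^(1/(N-1))], one for each direction. *)
  have -> : (`|f x| `^ q)%:E = (\prod_(i < N) (`|f x| `^ gam)%:E `^ p)%E.
    under eq_bigr do rewrite poweR_EFin.
    rewrite prodEFin prodr_const card_ord -powR_mulrn ?powR_ge0// -!powRrM.
    by rewrite mulrA gampq.
  apply: lee_prod => i _; first exact: poweR_ge0.
  rewrite gt0_ler_poweR ?in_itv/= ?leey ?andbT ?lee_fin ?powR_ge0 ?(ltW p0)//.
    exact: marginal_ge0.
  exact: powR_norm_le_marginal.
apply: (le_trans (loomis_whitney mF F0)).
apply: (@le_trans _ _ (\prod_(i < N) ((gam * (s * d) `^ 2^-1)%:E `^ p))%E).
  apply: lee_prod => i _; first exact: poweR_ge0.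
  rewrite gt0_ler_poweR ?in_itv/= ?leey ?andbT ?(ltW p0)//.
    exact: integral_ge0.
  by rewrite lee_fin mulr_ge0 ?powR_ge0// ltW.
under eq_bigr do rewrite poweR_EFin.
by rewrite prodEFin prodr_const card_ord.
Qed.

End sobolev.

(** * Hardy's inequality *)

Section hardy.
Context {R : realType} {n : nat}.

Definition sqn (x : 'rV[R]_n) : R := \sum_i x ord0 i ^+ 2.

Lemma sqn_ge0 x : 0 <= sqn x.
Proof. by apply: sumr_ge0 => i _; exact: sqr_ge0. Qed.

Lemma continuous_sqn : continuous sqn.
Proof.
rewrite /sqn.
apply: (continuous_big (op := +%R) _ _) => [|i _ x]; first exact: add_continuous.
rewrite (_ : (fun x : 'rV[R]_n => x ord0 i ^+ 2) = (fun x => x ord0 i * x ord0 i)).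
  have c : continuous (fun x : 'rV[R]_n => x ord0 i) by exact: coord_continuous.
  exact: cvgM (c x) (c x).
by apply/funext => y; rewrite expr2.
Qed.

Lemma sqn_upd i t x : sqn (upd i t x) = t ^+ 2 + \sum_(j | j != i) x ord0 j ^+ 2.
Proof.
rewrite /sqn (bigD1 i)//= mxE eqxx; congr (_ + _).
by apply: eq_bigr => j ji; rewrite mxE (negbTE ji).
Qed.

(** Here [t] is the coordinate along a line and [c] collects [eps] and the squares of the other
    coordinates, so that [t^2 + c] is [|x|^2 + eps]. *)
Lemma is_derive_hardy (F : R -> R) (t a c : R) : is_derive t 1 F a -> 0 < c ->
  is_derive t 1 (fun t => F t ^+ 2 * t * (t ^+ 2 + c)^-1)
    (2 * F t * a * t * (t ^+ 2 + c)^-1 +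
     F t ^+ 2 * ((t ^+ 2 + c)^-1 - 2 * t ^+ 2 * (t ^+ 2 + c)^-1 ^+ 2)).
Proof.
move=> dF c0.
have tc : t ^+ 2 + c != 0 by rewrite gt_eqF// ltr_wpDl// sqr_ge0.
have dq : is_derive t 1 (fun t : R => t ^+ 2 + c) (2 * t).
  apply: (@is_derive_eq _ _ _ ((@id R) ^+ 2 + cst c) t 1 _ _ _).
  by rewrite /GRing.scale/= mulr1 addr0 expr1.
have dV := @is_deriveV _ (fun t : R => t ^+ 2 + c) t _ _ tc dq.
have dP : is_derive t 1 (fun t : R => F t ^+ 2 * t) (2 * F t * a * t + F t ^+ 2).
  apply: (@is_derive_eq _ _ _ (F ^+ 2 * (@id R)) t 1 _ _ _).
  by rewrite /GRing.scale/= !mulr1 expr1 addrC; congr (_ + _); ring.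
apply: (@is_derive_eq _ _ _ ((fun t : R => F t ^+ 2 * t) * (fun t : R => (t ^+ 2 + c)^-1)) t 1 _ _
  (is_deriveM dP dV)).
by rewrite /GRing.scale/=; field.
Qed.

Variables (f : 'rV[R]_n -> R) (eps : R).
Hypotheses (Cf : C1c f) (eps0 : 0 < eps).

Let w x := (sqn x + eps)^-1.

Let se x : 0 < sqn x + eps. Proof. by rewrite ltr_wpDl// sqn_ge0. Qed.
Let w0 x : 0 < w x. Proof. by rewrite invr_gt0. Qed.

Let cw : continuous w.
Proof.
have ce : continuous (fun x => sqn x + eps).
  by move=> x; exact: cvgD (@continuous_sqn x) (cvg_cst _).
by move=> x; apply: (cvgV (lt0r_neq0 (se x)) (ce x)).
Qed.

Let cM (g h : 'rV[R]_n -> R) : continuous g -> continuous h -> continuous (fun x => g x * h x).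
Proof. by move=> cg ch x; exact: cvgM (cg x) (ch x). Qed.

Let cD (g h : 'rV[R]_n -> R) : continuous g -> continuous h -> continuous (fun x => g x + h x).
Proof. by move=> cg ch x; exact: cvgD (cg x) (ch x). Qed.

Let cK (c : R) : continuous (fun _ : 'rV[R]_n => c).
Proof. exact: cst_continuous. Qed.

(** Along a line, the derivative of [f^2 x_i w] is [f^2 w - 2 f^2 x_i^2 w^2 + 2 f x_i w D_i f] and
    integrates to zero. The cross term is split by Young's inequality with parameter [eta]. *)
Lemma hardy_coord i (eta : R) : 0 < eta ->
  (\int[lebesgue_rV n]_x (f x * f x * w x)%:E <=
   \int[lebesgue_rV n]_x ((2 + eta) * (f x * f x * (x ord0 i * x ord0 i) * (w x * w x)) +
       eta^-1 * ('D_(evec i) f x * 'D_(evec i) f x))%:E)%E.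
Proof.
move=> eta0; have [cf df cDf [K fK]] := Cf.
pose P x := f x * f x * w x.
pose Q x := (2 + eta) * (f x * f x * (x ord0 i * x ord0 i) * (w x * w x)) +
       eta^-1 * ('D_(evec i) f x * 'D_(evec i) f x).
pose G' x := 2 * f x * 'D_(evec i) f x * x ord0 i * w x +
     (f x * f x) * (w x + (-2) * (x ord0 i * x ord0 i) * (w x * w x)).
have cx : continuous (fun x : 'rV[R]_n => x ord0 i) by exact: coord_continuous.
have cP : continuous P by exact: cM (cM cf cf) cw.
have cQ : continuous Q.
  rewrite /Q; by repeat first [exact: cf | exact: cx | exact: cw | exact: cDf
    | apply: cD | apply: cM | exact: cK].
have cG' : continuous G'.
  rewrite /G'; by repeat first [exact: cf | exact: cx | exact: cw | exact: cDf
    | apply: cD | apply: cM | exact: cK].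
have P0 x : 0 <= P x by rewrite mulr_ge0 ?(ltW (w0 _))// -expr2 sqr_ge0.
have Q0 x : 0 <= Q x.
  have sq (a : R) : 0 <= a * a by rewrite -expr2 sqr_ge0.
  apply: addr_ge0; apply: mulr_ge0; [by rewrite addr_ge0// ltW| |by rewrite invr_ge0 ltW|exact: sq].
  by apply: mulr_ge0; [apply: mulr_ge0; exact: sq|exact: sq].
apply: (@le_integral_marginal R n i (fun x => (P x)%:E) (fun x => (Q x)%:E)) => //.
- by apply/measurable_EFinP; exact: continuous_measurable_rV.
- by apply/measurable_EFinP; exact: continuous_measurable_rV.
move=> x; rewrite /marginal.
have cl (g : 'rV[R]_n -> R) : continuous g -> continuous (fun t : R => g (upd i t x)).
  move=> cg t; apply: (@continuous_comp _ _ _ (fun t : R => upd i t x) g); last exact: cg.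
  exact: continuous_upd.
pose g (t : R) := f (upd i t x) ^+ 2 * t * w (upd i t x).
have fK' t : K <= `|t| -> f (upd i t x) = 0.
  by move=> Kt; apply: fK; exact: le_trans Kt (norm_upd_ge _ _ _).
apply: (@le_integral_derive _ g (fun t => G' (upd i t x)) (fun t => P (upd i t x))
  (fun t => Q (upd i t x)) K).
- exact: cl.
- exact: cl.
- exact: cl.
- move=> t; rewrite /g /G' /w.
  under eq_fun do rewrite sqn_upd -addrA.
  have c0 : 0 < \sum_(j | j != i) x ord0 j ^+ 2 + eps.
    by rewrite ltr_wpDl// sumr_ge0// => j _; exact: sqr_ge0.
  have h := is_derive_hardy (is_derive_line t x (df i)) c0.
  apply: (is_derive_eq h).
  rewrite sqn_upd -addrA mxE eqxx; ring.
- by move=> t Kt; rewrite /g fK'// expr0n !mul0r.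
- by move=> t Kt; rewrite /P fK'// !mul0r.
- by move=> t; exact: Q0.
- move=> t; move: (upd i t x) => y; rewrite -subr_ge0.
  have -> : Q y + G' y - P y = eta * (f y * y ord0 i * w y + 'D_(evec i) f y / eta) ^+ 2.
    by rewrite /Q /G' /P; field; rewrite gt_eqF.
  by rewrite mulr_ge0 ?sqr_ge0// ltW.
Qed.

Lemma hardy (d : R) : (2 < n)%N ->
  (forall i, (\int[lebesgue_rV n]_x ('D_(evec i) f x ^+ 2)%:E <= d%:E)%E) ->
  (\int[lebesgue_rV n]_x (f x ^+ 2 / (sqn x + eps))%:E <=
    (n%:R * (2 / (n%:R - 2)) ^+ 2 * d)%:E)%E.
Proof.
move=> n2 Dd; have [cf df cDf [K fK]] := Cf.
have m2 : 0 < n%:R - 2 :> R by rewrite subr_gt0 ltr_nat.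
(* With [A] the integral to be bounded, summation over [i] gives [n A <= (2 + eta) A + n d / eta],
   that is [A <= n d / (eta (n - 2 - eta))]. This [eta] minimizes the bound. *)
pose eta : R := (n%:R - 2) / 2.
have eta0 : 0 < eta by rewrite divr_gt0.
have sq (a : R) : 0 <= a * a by rewrite -expr2 sqr_ge0.
have cx i : continuous (fun x : 'rV[R]_n => x ord0 i) by exact: coord_continuous.
pose P x := f x * f x * w x.
pose T i x := f x * f x * (x ord0 i * x ord0 i) * (w x * w x).
have cP : continuous P by exact: cM (cM cf cf) cw.
have cT i : continuous (T i).
  exact: cM (cM (cM cf cf) (cM (cx i) (cx i))) (cM cw cw).
have mP : measurable_fun setT (fun x => (P x)%:E).
  by apply/measurable_EFinP; exact: continuous_measurable_rV.
have mT i : measurable_fun setT (fun x => (T i x)%:E).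
  by apply/measurable_EFinP; exact: continuous_measurable_rV.
have mD i : measurable_fun setT (fun x => ('D_(evec i) f x * 'D_(evec i) f x)%:E).
  by apply/measurable_EFinP; apply: continuous_measurable_rV; exact: cM.
have P0 x : 0 <= P x by rewrite mulr_ge0 ?(ltW (w0 _)).
have T0 i x : 0 <= T i x.
  by apply: mulr_ge0; [apply: mulr_ge0; exact: sq|exact: sq].
(* The sum of the [x_i^2 w] is [|x|^2 / (|x|^2 + eps)], at most 1. *)
have PT x : \sum_i T i x <= P x.
  have -> : \sum_i T i x = P x * (sqn x * w x).
    rewrite (eq_bigr (fun i => x ord0 i ^+ 2 * (f x * f x * (w x * w x)))); last first.
      by move=> i _; rewrite /T; ring.
    by rewrite -mulr_suml -/(sqn x) /P; ring.
  by rewrite ler_piMr// /w ler_pdivrMr// mul1r lerDl ltW.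
have TP i x : T i x <= P x.
  by apply: le_trans (PT x); rewrite (bigD1 i)//= lerDl sumr_ge0.
pose A := (\int[lebesgue_rV n]_x (P x)%:E)%E.
have PK x : K <= `|x| -> P x = 0 by move=> Kx; rewrite /P fK// !mul0r.
(* Finiteness, from [eps > 0] and compact support, allows [(2 + eta) A] to be subtracted later. *)
have Aoo : (A < +oo)%E.
  have [B B0 PB] := compact_supp_bounded cP PK.
  apply: (@compact_supp_integral_lty _ _ P K B) => //.
    exact: continuous_measurable_rV.
  by move=> x; rewrite P0/= -[P x]ger0_norm.
have A0 : (0 <= A)%E by apply: integral_ge0 => x _; rewrite lee_fin.
pose a := fine A.
have AE : A = a%:E by rewrite fineK// ge0_fin_numE.
pose I i := (\int[lebesgue_rV n]_x (T i x)%:E)%E.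
have I0 i : (0 <= I i)%E by apply: integral_ge0 => x _; rewrite lee_fin.
have IA i : (I i <= A)%E.
  by apply: ge0_le_integral => //= x _; rewrite lee_fin.
pose t i := fine (I i).
have IE i : I i = (t i)%:E by rewrite fineK// ge0_fin_numE// (le_lt_trans (IA i)).
have sumt : \sum_i t i <= a.
  rewrite -lee_fin -AE -sumEFin.
  under eq_bigr do rewrite -IE.
  rewrite -ge0_integral_sum//; last by move=> i x _; rewrite lee_fin.
  apply: ge0_le_integral => //.
  - by move=> x _; apply: sume_ge0 => i _; rewrite lee_fin.
  - exact: emeasurable_sum.
  - by move=> x _; rewrite sumEFin lee_fin.
have coord i : a <= (2 + eta) * t i + eta^-1 * d.
  have et0 : 0 <= 2 + eta by rewrite addr_ge0// ltW.
  have ei0 : 0 <= eta^-1 by rewrite invr_ge0 ltW.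
  rewrite -lee_fin -AE; apply: (le_trans (hardy_coord i eta0)).
  have -> : (\int[lebesgue_rV n]_x ((2 + eta) * (f x * f x * (x ord0 i * x ord0 i) * (w x * w x))
        + eta^-1 * ('D_(evec i) f x * 'D_(evec i) f x))%:E =
      \int[lebesgue_rV n]_x ((2 + eta)%:E * (T i x)%:E +
        eta^-1%:E * ('D_(evec i) f x * 'D_(evec i) f x)%:E))%E.
    by apply: eq_integral => x _; rewrite EFinD !EFinM.
  rewrite ge0_integralD//; last 4 first.
  - by move=> x _; rewrite mule_ge0// lee_fin.
  - exact: emeasurable_funM.
  - by move=> x _; rewrite mule_ge0// lee_fin.
  - exact: emeasurable_funM.
  rewrite !ge0_integralZl_EFin//; try by move=> x _; rewrite lee_fin.
  rewrite -/(I i) IE [leRHS]EFinD (EFinM (2 + eta)) (EFinM eta^-1) leeD2l//.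
  rewrite lee_pmul2l ?lte_fin ?invr_gt0//.
  by under eq_integral do rewrite -expr2.
have suma : n%:R * a <= (2 + eta) * a + eta^-1 * (n%:R * d).
  have -> : n%:R * a = \sum_(i < n) a by rewrite sumr_const card_ord mulr_natl.
  have et0 : 0 <= 2 + eta by rewrite addr_ge0// ltW.
  apply: (le_trans (ler_sum _ (fun i _ => coord i))).
  rewrite big_split/= -mulr_sumr sumr_const card_ord -[_ *+ n]mulr_natl.
  by rewrite [n%:R * (_ * _)]mulrCA lerD2r ler_wpM2l.
have -> : (\int[lebesgue_rV n]_x (f x ^+ 2 / (sqn x + eps))%:E = A)%E.
  by apply: eq_integral => x _; rewrite expr2.
rewrite AE lee_fin.
have {suma} : eta * a <= eta^-1 * (n%:R * d).
  have E : eta * a = n%:R * a - (2 + eta) * a by rewrite /eta; field.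
  by rewrite E lerBlDl.
rewrite -ler_pdivlMl// => /le_trans; apply.
rewrite le_eqVlt; apply/orP; left; apply/eqP.
by rewrite /eta; field; rewrite gt_eqF.
Qed.

End hardy.

(** * The Hardy-Sobolev inequality *)

(** Young's inequality for powers of [a / A] and [b / B]. If [a] and [b] are functions with
    integrals at most [A] and [B], integrating it bounds the integral of the left side by
    [A^theta B^(1-theta)]. *)
Lemma young_scaled {R : realType} (a b A B theta : R) :
  0 <= a -> 0 <= b -> 0 < A -> 0 < B -> 0 < theta < 1 ->
  a `^ theta * b `^ (1 - theta) <=
  A `^ theta * B `^ (1 - theta) * (theta / A * a + (1 - theta) / B * b).
Proof.
move=> a0 b0 A0 B0 /andP[t0 t1].
have t1' : 0 < 1 - theta by rewrite subr_gt0.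
have aA : 0 <= a / A by rewrite divr_ge0// ltW.
have bB : 0 <= b / B by rewrite divr_ge0// ltW.
have := @conjugate_powR R ((a / A) `^ theta) ((b / B) `^ (1 - theta)) theta^-1 (1 - theta)^-1.
rewrite !powR_ge0 !invr_gt0 !invrK => /(_ isT isT t0 t1').
rewrite addrC subrK -!powRrM !mulfV ?(gt_eqF t0) ?(gt_eqF t1')// !powRr1// => /(_ erefl) h.
rewrite -[a in leLHS](mulfVK (lt0r_neq0 A0)) -[b in leLHS](mulfVK (lt0r_neq0 B0)).
rewrite (powRM _ aA (ltW A0)) (powRM _ bB (ltW B0)).
set x := _ `^ theta in h *; set y := _ `^ (1 - theta) in h *.
rewrite (_ : _ * _ = A `^ theta * B `^ (1 - theta) * (x * y)); last by ring.
rewrite ler_pM2l ?mulr_gt0 ?powR_gt0// (le_trans h)//.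
by rewrite le_eqVlt; apply/orP; left; apply/eqP; ring.
Qed.

Section hardy_sobolev.
Context {R : realType} (n : nat) (s : R).
Hypothesis s02 : 0 < s < 2.
Let N := n.+3.

Lemma two_starE : two_star N s = 2 * (N%:R - s) / n.+1%:R.
Proof. by rewrite /two_star -[in LHS](natrB R (isT : 2 <= N)%N). Qed.

(* Keeping [eps] lets the singular weight and the approximating sequence be
   handled by a single application of Fatou's lemma. *)
Lemma hardy_sobolev : exists2 C : R, 0 < C &
  forall (f : 'rV[R]_N -> R) (eps d : R), C1c f -> 0 < eps -> 0 < d ->
  (forall i, (\int[lebesgue_rV N]_x ('D_(evec i) f x ^+ 2)%:E <= d%:E)%E) ->
  (\int[lebesgue_rV N]_x (`|f x| `^ two_star N s / (sqn x + eps) `^ (s / 2))%:E <=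
   (C * d `^ (two_star N s / 2))%:E)%E.
Proof.
have /andP[s0 s2] := s02.
(* The weight of Hardy's inequality in the interpolation: [2 th + q (1 - th) = 2^*(s)], and the
   factor [1 / (|x|^2 + eps)] raised to [th] is the required singular weight. *)
pose th := s / 2.
have th01 : 0 < th < 1 by rewrite /th divr_gt0//= ltr_pdivrMr// mul1r.
have /andP[th0 th1] := th01.
have th1' : 0 < 1 - th by rewrite subr_gt0.
pose q : R := 2 * N%:R / n.+1%:R.
pose CS : R := (2 * n.+2%:R / n.+1%:R) `^ q.
pose CH : R := N%:R * (2 / (N%:R - 2)) ^+ 2.
have NE : N%:R - 2 = n.+1%:R :> R by rewrite -(natrB R (isT : 2 <= N)%N).
have CS0 : 0 < CS by rewrite powR_gt0// divr_gt0// mulr_gt0.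
have CH0 : 0 < CH by rewrite /CH NE mulr_gt0// exprn_gt0// divr_gt0.
have n3E : N%:R = n.+1%:R + 2 :> R by rewrite -NE subrK.
have n1 : n.+1%:R != 0 :> R by [].
exists (CH `^ th * CS `^ (1 - th)); first by rewrite mulr_gt0// powR_gt0.
move=> f eps d Cf eps0 d0 Dd.
pose A := CH * d; pose B := CS * d `^ (N%:R / n.+1%:R).
have A0 : 0 < A by rewrite mulr_gt0.
have B0 : 0 < B by rewrite mulr_gt0// powR_gt0.
have hA : (\int[lebesgue_rV N]_x (f x ^+ 2 / (sqn x + eps))%:E <= A%:E)%E by exact: hardy.
have hB : (\int[lebesgue_rV N]_x (`|f x| `^ q)%:E <= B%:E)%E by exact: sobolev.
have p0 : 0 < two_star N s.
  rewrite two_starE divr_gt0// mulr_gt0// subr_gt0 (lt_trans s2)//.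
  by rewrite -subr_gt0 NE.
have se (x : 'rV[R]_N) : 0 < sqn x + eps by rewrite ltr_wpDl// sqn_ge0.
pose K := A `^ th * B `^ (1 - th).
(* Homogeneity: the exponents of [d] add up to [th + (1 - th) N/(N-2)], which is half of
   [two_star N s]. *)
have KE : K = CH `^ th * CS `^ (1 - th) * d `^ (two_star N s / 2).
  rewrite /K /A /B (powRM _ (ltW CH0) (ltW d0)).
  rewrite (powRM _ (ltW CS0) (powR_ge0 _ _)).
  rewrite (_ : two_star N s / 2 = th + N%:R / n.+1%:R * (1 - th)); last first.
    by rewrite two_starE /th n3E; field; rewrite nat1r n1.
  rewrite [d `^ (_ + _)]powRD; last by rewrite (gt_eqF d0) implybT.
  by rewrite (powRrM d (N%:R / n.+1%:R) (1 - th)) mulrACA.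
have K0 : 0 < K by rewrite mulr_gt0// powR_gt0.
rewrite -KE.
pose a x := f x ^+ 2 / (sqn x + eps).
have a0 x : 0 <= a x by rewrite divr_ge0 ?sqr_ge0// ltW.
have [cf _ _ _] := Cf.
have mf : measurable_fun setT f by exact: continuous_measurable_rV.
have cse : continuous (fun x : 'rV[R]_N => sqn x + eps).
  by move=> x; exact: cvgD (@continuous_sqn _ _ x) (cvg_cst _).
have ma : measurable_fun setT (fun x => (a x)%:E).
  apply/measurable_EFinP/measurable_funM; first exact: measurable_funX.
  apply: continuous_measurable_rV => x.
  exact: (cvgV (lt0r_neq0 (se x)) (cse x)).
have mb : measurable_fun setT (fun x => (`|f x| `^ q)%:E) by exact: measurable_C1c_powR.
have pt x : `|f x| `^ two_star N s / (sqn x + eps) `^ (s / 2) <=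
    K * (th / A) * a x + K * ((1 - th) / B) * `|f x| `^ q.
  have -> : `|f x| `^ two_star N s / (sqn x + eps) `^ (s / 2) =
      a x `^ th * (`|f x| `^ q) `^ (1 - th).
    rewrite /a powRM ?sqr_ge0 ?invr_ge0 ?(ltW (se x))//.
    rewrite -[in RHS](powR_inv1 (ltW (se x))) -[in RHS]powRrM mulN1r powRN.
    rewrite mulrAC; congr (_ / _).
    rewrite -(real_normK (num_real (f x))) -powR_mulrn// -!powRrM -powRD.
      by congr (_ `^ _); rewrite two_starE /th /q n3E; field; rewrite nat1r n1.
    rewrite (_ : 2 * th + q * (1 - th) = two_star N s) ?(gt_eqF p0)//.
    by rewrite two_starE /th /q n3E; field; rewrite nat1r n1.
  apply: (le_trans (young_scaled (a0 x) (powR_ge0 `|f x| q) A0 B0 th01)).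
  by rewrite -/K mulrDr !mulrA.
apply: (@le_trans _ _ (\int[lebesgue_rV N]_x ((K * (th / A))%:E * (a x)%:E +
    (K * ((1 - th) / B))%:E * (`|f x| `^ q)%:E))%E).
  apply: ge0_le_integral => //=.
  - by move=> x _; rewrite lee_fin divr_ge0// powR_ge0.
  - under eq_fun do rewrite -powRN.
    apply/measurable_EFinP/measurable_funM.
      by apply: (measurableT_comp (measurable_powR _)); exact: measurableT_comp.
    by apply: (measurableT_comp (measurable_powR _)); exact: continuous_measurable_rV.
  - by apply: emeasurable_funD; exact: emeasurable_funM.
  - by move=> x _; rewrite -!EFinM -EFinD lee_fin.
have c1 : 0 < K * (th / A) by rewrite mulr_gt0// divr_gt0.
have c2 : 0 < K * ((1 - th) / B) by rewrite mulr_gt0// divr_gt0.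
rewrite ge0_integralD//; last 4 first.
- by move=> x _; rewrite mule_ge0// lee_fin// ltW.
- exact: emeasurable_funM.
- by move=> x _; rewrite mule_ge0// lee_fin// ?powR_ge0// ltW.
- exact: emeasurable_funM.
rewrite !ge0_integralZl_EFin ?(ltW c1) ?(ltW c2)//; try by move=> x _; rewrite lee_fin ?powR_ge0.
apply: (@le_trans _ _ ((K * (th / A))%:E * A%:E + (K * ((1 - th) / B))%:E * B%:E)%E).
  by apply: leeD; rewrite lee_pmul2l// lte_fin.
(* The two terms are [K th] and [K (1 - th)], with sum [K]. *)
rewrite -!EFinM -EFinD lee_fin le_eqVlt; apply/orP; left; apply/eqP.
by field; rewrite !gt_eqF.
Qed.

End hardy_sobolev.

(** * The Euclidean norm and test functions *)

Section enorm.
Context {R : realType} {n : nat}.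
Implicit Types x y : 'rV[R]_n.

Lemma enorm_sqr x : enorm x ^+ 2 = sqn x.
Proof. by rewrite /enorm sqr_sqrtr// sqn_ge0. Qed.

Lemma enorm_powR x (s : R) : enorm x `^ s = sqn x `^ (s / 2).
Proof. by rewrite mulrC powRrM powR12_sqrt// sqn_ge0. Qed.

Lemma sqnB x y : sqn (x - y) = sqn (y - x).
Proof. by apply: eq_bigr => i _; rewrite !mxE -opprB sqrrN. Qed.

Lemma sqn_le x y : sqn x <= 2 * sqn (x - y) + 2 * sqn y.
Proof.
rewrite /sqn !mulr_sumr -big_split/=; apply: ler_sum => i _; rewrite !mxE.
(* The difference of the two sides is exactly [(x_i - 2 y_i)^2]. *)
rewrite -subr_ge0; have := sqr_ge0 (x ord0 i - 2 * y ord0 i).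
by rewrite !expr2; nra.
Qed.

Lemma measurable_enorm_powRV (s : R) :
  measurable_fun setT (fun x : 'rV[R]_n => (enorm x `^ s)^-1).
Proof.
under eq_fun do rewrite enorm_powR -powRN.
by apply: (measurableT_comp (measurable_powR _));
  apply: continuous_measurable_rV; exact: continuous_sqn.
Qed.

Lemma coord_sqr_le x i : x ord0 i ^+ 2 <= sqn x.
Proof.
by rewrite /sqn (bigD1 i)//= lerDl sumr_ge0// => j _; exact: sqr_ge0.
Qed.

Lemma sqn_eq0 x : (sqn x == 0) = (x == 0).
Proof.
apply/idP/eqP => [|->]; last by rewrite /sqn big1// => i _; rewrite mxE expr0n.
rewrite psumr_eq0 => [/allP h|i _]; last exact: sqr_ge0.
apply/rowP => i; rewrite mxE; apply/eqP.
by have := h i (mem_index_enum _); rewrite sqrf_eq0.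
Qed.

End enorm.

Section test_functions.
Context {R : realType} {n : nat} (Omega : set 'rV[R]_n) (f : 'rV[R]_n -> R).
Hypothesis tf : test_function Omega f.

Lemma test_function_C1c : C1c f.
Proof.
have [sm cpt _] := tf; have [cf h] := sm 1%N.
split => //.
- by move=> i x; have [] := h i.
- by move=> i; have [_ []] := h i.
have [M [_ /(_ (`|M| + 1))]] := compact_bounded cpt.
rewrite (le_lt_trans (ler_norm M)) ?ltrDl// => /(_ isT) fB.
exists (`|M| + 2) => x Mx; apply/eqP/negPn/negP => fx0.
have : `|x| <= `|M| + 1 by apply: fB; exact: subset_closure.
by move=> /(le_trans Mx); rewrite lerD2l; lra.
Qed.

(** The complement of the support is an open neighbourhood of [x] on which [f] is zero. This
    identifies integrals of derivatives over [Omega] with integrals over the whole space. *)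
Lemma test_function_deriv_out i x : ~ Omega x -> 'D_(evec i) f x = 0.
Proof.
have [_ _ sub] := tf => nx.
have oC : open (~` fsupport f) by apply: closed_openC; exact: closed_closure.
have : nbhs x (~` fsupport f) by apply: open_nbhs_nbhs; split => // /sub.
move=> nf; have : is_derive x (evec i) f 0.
  apply: near_eq_is_derive (is_derive_cst (0 : R) x (evec i)).
  apply: filterS nf => y /= nfy; apply/esym/eqP/negPn/negP => fy0.
  by apply: nfy; exact: subset_closure.
by move=> ?; rewrite derive_val.
Qed.

End test_functions.

(** * Passage from test functions to [D_0^{1,2}] *)

Section D012.
Context {R : realType} {n : nat} (s : R).
Let N := n.+3.
Context (Omega : set 'rV[R]_N).
Hypothesis oO : open Omega.
Local Notation mu := (lebesgue_rV N).

Let mO : measurable Omega. Proof. exact: open_measurable_rV. Qed.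

Let msqn (g : 'rV[R]_N -> 'rV[R]_N) : measurable_fun Omega g ->
  measurable_fun Omega (fun x => (sqn (g x))%:E).
Proof.
move=> mg; apply/measurable_EFinP.
apply: (measurable_comp measurableT _ _ mg) => //.
by apply: continuous_measurable_rV; exact: continuous_sqn.
Qed.

Let mgrad (f : 'rV[R]_N -> R) : C1c f -> measurable_fun Omega (grad f).
Proof.
move=> [_ _ cD _]; apply: measurable_funTS; apply: measurable_rVP => i.
rewrite (_ : (fun _ => _) = 'D_(evec i) f); last by apply/funext => x; rewrite mxE.
exact: continuous_measurable_rV.
Qed.

Let mcoord (g : 'rV[R]_N -> 'rV[R]_N) i : measurable_fun Omega g ->
  measurable_fun Omega (fun x => g x ord0 i).
Proof. by move=> mg; exact: (measurable_comp measurableT _ (measurable_coord_rV i) mg). Qed.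

Let msqnB (g h : 'rV[R]_N -> 'rV[R]_N) : measurable_fun Omega g -> measurable_fun Omega h ->
  measurable_fun Omega (fun x => (sqn (g x - h x))%:E).
Proof.
move=> mg mh; apply/measurable_EFinP; apply: measurable_sum => i.
apply: measurable_funX; under eq_fun do rewrite !mxE.
by apply: measurable_funB; exact: mcoord.
Qed.

Variable u : D012 Omega.

Let D := (\int[mu]_(x in Omega) (enorm (D012_grad u x) ^+ 2)%:E)%E.

Let phi := sval (cid (D012_approx u)).
Let tphi k : test_function Omega (phi k).
Proof. by rewrite /phi; case: cid => ? []. Qed.
Let phi_u : {ae mu, forall x, Omega x -> phi k x @[k --> \oo] --> u x}.
Proof. by rewrite /phi; case: cid => ? []. Qed.
Let e k := (\int[mu]_(x in Omega) (sqn (grad (phi k) x - D012_grad u x))%:E)%E.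
Let e0 : e k @[k --> \oo] --> 0%E.
Proof.
rewrite (_ : e = fun k => (\int[mu]_(x in Omega)
    (enorm (grad (phi k) x - D012_grad u x) ^+ 2)%:E)%E); last first.
  by apply/funext => k; apply: eq_integral => x _; rewrite enorm_sqr.
by rewrite /phi; case: cid => f /= [_ h _]; exact: h.
Qed.

Let Cphi k : C1c (phi k). Proof. exact: test_function_C1c (tphi k). Qed.

Let mgu : measurable_fun Omega (D012_grad u). Proof. exact: D012_grad_measurable. Qed.

Let DE : D = (\int[mu]_(x in Omega) (sqn (D012_grad u x))%:E)%E.
Proof. by apply: eq_integral => x _; rewrite enorm_sqr. Qed.

Let gradE (f : 'rV[R]_N -> R) x : sqn (grad f x) = \sum_i 'D_(evec i) f x ^+ 2.
Proof. by apply: eq_bigr => i _; rewrite mxE. Qed.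

Let e_lt (c : R) : 0 < c -> \forall k \near \oo, (e k < c%:E)%E.
Proof.
move=> c0; have /fine_cvgP[efin ecvg] := e0.
near=> k; rewrite -[e k]fineK; last by near: k.
rewrite lte_fin; near: k; exact: cvgr_lt ecvg _ c0.
Unshelve. all: by end_near. Qed.

Let sqn0 (g : 'rV[R]_N -> 'rV[R]_N) x : (0 <= (sqn (g x))%:E)%E.
Proof. by rewrite lee_fin sqn_ge0. Qed.

Let mg k : measurable_fun Omega (fun x => (sqn (grad (phi k) x))%:E).
Proof. by apply: msqn; exact: mgrad. Qed.

Let md k : measurable_fun Omega (fun x => (sqn (grad (phi k) x - D012_grad u x))%:E).
Proof. by apply: msqnB => //; exact: mgrad. Qed.

Let mDg : measurable_fun Omega (fun x => (sqn (D012_grad u x))%:E).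
Proof. exact: msqn. Qed.

(** The gradient of [u] is at finite [L^2] distance from that of some test function [phi k], which
    is square integrable by compact support. *)
Lemma D012_grad_sqr_lty : (D < +oo)%E.
Proof.
have [k _ /(_ k (leqnn k)) /= ek] := e_lt ltr01.
apply: (@le_lt_trans _ _ (2%:E * e k +
  2%:E * \int[mu]_(x in Omega) (sqn (grad (phi k) x))%:E)%E).
  rewrite DE -!ge0_integralZl_EFin//.
  rewrite -ge0_integralD//; last 4 first.
  - by move=> x _; rewrite mule_ge0// sqn0.
  - exact: emeasurable_funM.
  - by move=> x _; rewrite mule_ge0// sqn0.
  - exact: emeasurable_funM.
  apply: ge0_le_integral => //=.
  - by apply: emeasurable_funD; exact: emeasurable_funM.
  - by move=> x _; rewrite -!EFinM -EFinD lee_fin sqnB; exact: sqn_le.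
rewrite lte_add_pinfty// lte_mul_pinfty//; first exact: lt_trans ek (ltry _).
apply: (@le_lt_trans _ _ (\sum_i \int[mu]_x ('D_(evec i) (phi k) x ^+ 2)%:E)%E).
  rewrite -ge0_integral_sum//; last 2 first.
  - by move=> i; exact: measurable_C1c_deriv_sqr.
  - by move=> i x _; rewrite lee_fin sqr_ge0.
  under [leRHS]eq_integral do rewrite sumEFin -gradE.
  apply: ge0_subset_integral => //.
  apply/measurable_EFinP.
  under eq_fun do rewrite gradE.
  apply: measurable_sum => i; apply/measurable_EFinP.
  exact: measurable_C1c_deriv_sqr.
by apply: lte_sum_pinfty => i _; exact: C1c_deriv_sqr_lty.
Qed.

(** Derivatives of [phi k] vanish off [Omega], so the integral reduces to one over [Omega]. The
    bound [sqn_le] costs a factor 2, which only affects the final constant. *)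
Let deriv_le k i : (\int[mu]_x ('D_(evec i) (phi k) x ^+ 2)%:E <= 2%:E * e k + 2%:E * D)%E.
Proof.
have -> : (\int[mu]_x ('D_(evec i) (phi k) x ^+ 2)%:E =
    \int[mu]_(x in Omega) ('D_(evec i) (phi k) x ^+ 2)%:E)%E.
  rewrite [RHS]integral_mkcond; apply: eq_integral => x _.
  rewrite patchE; case: ifPn => // /negP xO.
  by rewrite (test_function_deriv_out (tphi k)) ?expr0n// => Ox; apply: xO; rewrite inE.
rewrite DE -!ge0_integralZl_EFin//.
rewrite -ge0_integralD//; last 4 first.
- by move=> x _; rewrite mule_ge0// sqn0.
- exact: emeasurable_funM.
- by move=> x _; rewrite mule_ge0// sqn0.
- exact: emeasurable_funM.
apply: ge0_le_integral => //.
- by move=> x _; rewrite lee_fin sqr_ge0.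
- by apply: measurable_funTS; exact: measurable_C1c_deriv_sqr.
- by apply: emeasurable_funD; exact: emeasurable_funM.
move=> x _; rewrite -!EFinM -EFinD lee_fin (le_trans _ (sqn_le _ _))//.
by rewrite (le_trans _ (coord_sqr_le _ i))// mxE.
Qed.

Hypothesis s02 : 0 < s < 2.
Let p := two_star N s.
(** The regularization [1/(k+1)] is tied to the index of the approximating sequence. *)
Let F k (x : 'rV[R]_N) := `|phi k x| `^ p / (sqn x + k.+1%:R^-1) `^ (s / 2).
Let G (x : 'rV[R]_N) := `|u x| `^ p / enorm x `^ s.

Let p0 : 0 < p.
Proof.
have /andP[s0 s2] := s02.
rewrite /p two_starE divr_gt0// mulr_gt0// subr_gt0 (lt_trans s2)//.
by rewrite ltr_nat.
Qed.

Let s20 : 0 < s / 2. Proof. by have /andP[s0 _] := s02; rewrite divr_gt0. Qed.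

Let F0 k x : 0 <= F k x. Proof. by rewrite divr_ge0// powR_ge0. Qed.
Let G0 x : 0 <= G x. Proof. by rewrite divr_ge0// powR_ge0. Qed.

Let limn_einf_ge0 (a : nat -> \bar R) : (forall k, (0 <= a k)%E) -> (0 <= limn_einf a)%E.
Proof.
move=> a0; rewrite limn_einf_lim; apply: lime_ge; first exact: is_cvg_einfs.
by apply: nearW => k; apply: le_ereal_inf_tmp => _ [j _ <-].
Qed.

Let limn_einf_le (a : nat -> \bar R) (c : \bar R) :
  (\forall k \near \oo, (a k <= c)%E) -> (limn_einf a <= c)%E.
Proof.
move=> ac; rewrite limn_einf_lim; apply: lime_le; first exact: is_cvg_einfs.
apply: filterS ac => k; apply: le_trans; apply: ereal_inf_lbound.
by exists k => //=.
Qed.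

Let G_le_liminf x : phi k x @[k --> \oo] --> u x ->
  ((G x)%:E <= limn_einf (fun k => (F k x)%:E))%E.
Proof.
move=> phix; have [x0|xn0] := eqVneq x 0.
  (* At the origin the weight is the inverse of 0, which is 0 by convention; thus [G 0 = 0] and the
     lower limit only has to be nonnegative. *)
  rewrite /G x0 enorm_powR (eqP (_ : sqn _ == 0)) ?sqn_eq0// powR0 ?gt_eqF//.
  by rewrite invr0 mulr0; apply: limn_einf_ge0 => k; rewrite lee_fin.
have sx0 : 0 < sqn x by rewrite lt_neqAle eq_sym sqn_eq0 xn0 sqn_ge0.
suff : F k x @[k --> \oo] --> G x.
  by move=> h; have /cvg_limn_einf_sup[-> _] : (F k x)%:E @[k --> \oo] --> (G x)%:E
    by apply: cvg_EFin => //; exact: nearW.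
rewrite /F /G enorm_powR; apply: cvgM.
  exact: (cvg_comp _ _ phix (@continuous_powR_norm R p p0 (u x))).
apply: cvgV; first by rewrite gt_eqF// powR_gt0.
have h : (sqn x + k.+1%:R^-1) @[k --> \oo] --> sqn x.
  rewrite -[X in _ --> X]addr0; apply: cvgD; first exact: cvg_cst.
  exact: cvg_harmonic.
have := cvg_comp _ _ h (@continuous_powR_norm R _ s20 (sqn x)).
rewrite ger0_norm ?sqn_ge0//; apply: cvg_trans; apply: near_eq_cvg; apply: nearW => k /=.
by rewrite ger0_norm// addr_ge0 ?sqn_ge0 ?invr_ge0.
Qed.

Let mu_u : measurable_fun Omega u. Proof. exact: D012_fun_measurable. Qed.

Let mG : measurable_fun Omega (fun x => (G x)%:E).
Proof.
apply/measurable_EFinP/measurable_funM; last first.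
  by apply: measurable_funTS; exact: measurable_enorm_powRV.
by apply: (measurableT_comp (measurable_powR _)); exact: measurableT_comp.
Qed.

Let mF k : measurable_fun setT (fun x => (F k x)%:E).
Proof.
have [cf _ _ _] := Cphi k.
under eq_fun do rewrite /F -powRN.
apply/measurable_EFinP/measurable_funM.
  by apply: (measurableT_comp (measurable_powR _)); apply: measurableT_comp => //;
    exact: continuous_measurable_rV.
apply: (measurableT_comp (measurable_powR _)); apply: measurable_funD => //.
by apply: continuous_measurable_rV; exact: continuous_sqn.
Qed.

Variable C : R.
Hypothesis C0 : 0 < C.
Hypothesis HC : forall (f : 'rV[R]_N -> R) (eps d : R), C1c f -> 0 < eps -> 0 < d ->
  (forall i, (\int[mu]_x ('D_(evec i) f x ^+ 2)%:E <= d%:E)%E) ->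
  (\int[mu]_x (`|f x| `^ p / (sqn x + eps) `^ (s / 2))%:E <= (C * d `^ (p / 2))%:E)%E.

(** Fatou's lemma along [F k]. The strict inequality leaves room for the error [2 e k] in the bound
    on the derivatives of [phi k], which is eventually below [d - 2 D]. *)
Let hardy_sobolev_lt :
  forall d, 2 * fine D < d -> (\int[mu]_(x in Omega) (G x)%:E <= (C * d `^ (p / 2))%:E)%E.
Proof.
move=> d Dd.
have D0 : (0 <= D)%E by apply: integral_ge0 => x _; rewrite lee_fin sqr_ge0.
have DfE : D = (fine D)%:E by rewrite fineK// ge0_fin_numE// D012_grad_sqr_lty.
have d0 : 0 < d by rewrite (le_lt_trans _ Dd)// mulr_ge0// fine_ge0.
have mlim : measurable_fun Omega (fun x => limn_einf (fun k => (F k x)%:E)).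
  rewrite (_ : (fun x => _) =
    (fun x => - limn_esup (fun k => - (F k x)%:E))%E); last first.
    apply/funext => x.
    by rewrite [X in (- X)%E](limn_esupN (fun k => (F k x)%:E)) oppeK.
  apply: measurableT_comp => //; apply: measurable_fun_limn_esup => k.
  by apply: measurableT_comp => //; apply: measurable_funTS; exact: mF.
apply: (@le_trans _ _ (\int[mu]_(x in Omega) limn_einf (fun k => (F k x)%:E))%E).
  apply: ae_ge0_le_integral => //.
  - by move=> x _; rewrite lee_fin.
  - by move=> x _; apply: limn_einf_ge0 => k; rewrite lee_fin.
  - by apply: filterS phi_u => x h /h; exact: G_le_liminf.
apply: (le_trans (fatou mu mO _ _)).
- by move=> k; apply: measurable_funTS; exact: mF.
- by move=> k x _; rewrite lee_fin.
apply: limn_einf_le.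
have c0 : 0 < (d - 2 * fine D) / 2 by rewrite divr_gt0// subr_gt0.
apply: filterS (e_lt c0) => k ek.
apply: (@le_trans _ _ (\int[mu]_x (F k x)%:E)%E).
  by apply: ge0_subset_integral => // x _; rewrite lee_fin.
apply: HC => // i.
apply: (le_trans (deriv_le k i)).
rewrite DfE (@le_trans _ _ (2%:E * ((d - 2 * fine D) / 2)%:E + 2%:E * (fine D)%:E)%E)//.
  by rewrite leeD2r// lee_pmul2l// ltW.
by rewrite -!EFinM -EFinD lee_fin; lra.
Qed.

Lemma D012_weighted_integrable : mu.-integrable Omega (EFin \o G).
Proof.
apply/integrableP; split => //.
under eq_integral do rewrite gee0_abs ?lee_fin//.
have h : 2 * fine D < 2 * fine D + 1 by rewrite ltrDl.
exact: le_lt_trans (hardy_sobolev_lt h) (ltry _).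
Qed.

(** Raised to the power [2/p], the right side of [hardy_sobolev_lt] is linear in [d], and [d]
    decreases to [2 D]. Approaching from above also covers [D = 0]. *)
Lemma D012_hardy_sobolev :
  (\int[mu]_(x in Omega) G x) `^ (2 / p) <=
  C `^ (2 / p) * (2 * \int[mu]_(x in Omega) (enorm (D012_grad u x) ^+ 2)).
Proof.
set I := \int[mu]_(x in Omega) G x.
have I0 : 0 <= I by exact: Rintegral_ge0.
have IE : I%:E = (\int[mu]_(x in Omega) (G x)%:E)%E.
  by rewrite fineK//; exact: integrable_fin_num D012_weighted_integrable.
rewrite -/(fine D).
have D0 : (0 <= D)%E by apply: integral_ge0 => x _; rewrite lee_fin sqr_ge0.
have Cp0 : 0 < C `^ (2 / p) by exact: powR_gt0.
rewrite -ler_pdivrMl//; apply/ler_addgt0Pr => eps eps0.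
have d0 : 0 < 2 * fine D + eps by rewrite ltr_wpDl// mulr_ge0// fine_ge0.
have := hardy_sobolev_lt (d := 2 * fine D + eps); rewrite -IE lee_fin ltrDl => /(_ eps0) h.
rewrite ler_pdivrMl//.
have := ge0_ler_powR (r := 2 / p) _ _ _ h.
rewrite (powRM _ (ltW C0) (powR_ge0 _ _)) -powRrM.
rewrite (_ : p / 2 * (2 / p) = 1); last by field; rewrite gt_eqF.
rewrite powRr1 ?(ltW d0)//; apply.
- by rewrite divr_ge0// ltW.
- by rewrite nnegrE.
- by rewrite nnegrE mulr_ge0 ?powR_ge0// ltW.
Qed.

End D012.

(** * The inequality for pairs of functions *)

Lemma powRM_le_sum {R : realType} (a b alpha beta : R) :
  0 <= a -> 0 <= b -> 0 < alpha -> 0 < beta ->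
  a `^ alpha * b `^ beta <= a `^ (alpha + beta) + b `^ (alpha + beta).
Proof.
move=> a0 b0 al0 be0.
wlog ab : a b alpha beta a0 b0 al0 be0 / a <= b.
  move=> H; have [|/ltW] := leP a b; first exact: H.
  by move=> ba; rewrite mulrC addrC [alpha + _]addrC H.
have ab0 : alpha + beta != 0 by rewrite gt_eqF// addr_gt0.
(* Replacing the smaller base by the larger one leaves a single power [b^(alpha+beta)]. *)
rewrite (le_trans (y := b `^ alpha * b `^ beta))//.
  by rewrite ler_wpM2r ?powR_ge0// ge0_ler_powR// ltW.
by rewrite -powRD ?(negbTE ab0)// lerDr powR_ge0.
Qed.

(** The sum is at most twice its larger term; the constant is crude but serves every exponent
    [r >= 0]. *)
Lemma powRD_le {R : realType} (a b r : R) : 0 <= a -> 0 <= b -> 0 <= r ->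
  (a + b) `^ r <= 2 `^ r * (a `^ r + b `^ r).
Proof.
move=> a0 b0 r0; wlog ab : a b a0 b0 / a <= b.
  move=> H; have [|/ltW] := leP a b; first exact: H.
  by move=> ba; rewrite addrC [a `^ r + _]addrC H.
rewrite (le_trans (y := (2 * b) `^ r))//.
  by rewrite ge0_ler_powR ?nnegrE ?addr_ge0 ?mulr_ge0//; lra.
by rewrite powRM// ler_wpM2l ?powR_ge0// lerDr powR_ge0.
Qed.

Theorem theorem1p1 (R : realType) (N : nat) (s alpha beta lambda mu kappa : R)
    (hN : (3 <= N)%N) (hs : 0 < s < 2) (halpha : 1 < alpha) (hbeta : 1 < beta)
    (hab : alpha + beta = two_star N s) :
  exists2 C : R, 0 < C &
  forall Omega : set 'rV[R]_N, domain Omega ->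
  forall w : DD Omega,
    let u := w.1 in
    let v := w.2 in
    let F := fun x : 'rV[R]_N =>
      lambda * (`|u x| `^ two_star N s / enorm x `^ s)
      + mu * (`|v x| `^ two_star N s / enorm x `^ s)
      + two_star N s * kappa
          * (`|u x| `^ alpha * `|v x| `^ beta / enorm x `^ s) in
    (lebesgue_rV N).-integrable Omega (EFin \o F) /\
    (* the power of a negative real being undefined, a negative integral is
       replaced by 0 *)
    \int[lebesgue_rV N]_(x in Omega) (enorm (D012_grad u x) ^+ 2)
    + \int[lebesgue_rV N]_(x in Omega) (enorm (D012_grad v x) ^+ 2)
    >= C * Num.max 0 (\int[lebesgue_rV N]_(x in Omega) F x)
             `^ (2 / two_star N s).
Proof.
case: N hN hab => [//|[//|[//|n]]] _ hab.
have [C0 C0_gt0 HC] := hardy_sobolev n hs.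
set p := two_star n.+3 s in hab HC *.
have al0 : 0 < alpha by rewrite (lt_trans ltr01).
have be0 : 0 < beta by rewrite (lt_trans ltr01).
have p0 : 0 < p by rewrite -hab addr_gt0.
have r0 : 0 <= 2 / p by rewrite divr_ge0// ltW.
(* The last summand keeps [K] positive even when all the coefficients vanish. *)
pose K := `|lambda| + `|mu| + `|p * kappa| + 1.
have K0 : 0 < K by rewrite ltr_wpDl// !addr_ge0.
(* The factors come from [|F| <= K (Gu + Gv)], from [powRD_le], and from [D012_hardy_sobolev]. All
   are fixed before [Omega], so the constant does not depend on the domain. *)
pose M := K `^ (2 / p) * (2 `^ (2 / p) * (C0 `^ (2 / p) * 2)).
have M0 : 0 < M by rewrite !mulr_gt0// powR_gt0.
exists M^-1; first by rewrite invr_gt0.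
move=> Omega [oO _ _] w u v F.
set nu := lebesgue_rV n.+3.
have mO : measurable Omega by exact: open_measurable_rV.
pose Gu x := `|u x| `^ p / enorm x `^ s.
pose Gv x := `|v x| `^ p / enorm x `^ s.
have iu : nu.-integrable Omega (EFin \o Gu) by exact: D012_weighted_integrable HC.
have iv : nu.-integrable Omega (EFin \o Gv) by exact: D012_weighted_integrable HC.
have iK : nu.-integrable Omega (EFin \o (fun x => K * (Gu x + Gv x))).
  apply: (eq_integrable mO (fun x => K%:E * ((EFin \o Gu) x + (EFin \o Gv) x))%E) => //.
  apply: integrableZl => //; exact: integrableD.
have Gu0 x : 0 <= Gu x by rewrite divr_ge0// powR_ge0.
have Gv0 x : 0 <= Gv x by rewrite divr_ge0// powR_ge0.
have FK x : `|F x| <= K * (Gu x + Gv x).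
  have H0 : 0 <= `|u x| `^ alpha * `|v x| `^ beta / enorm x `^ s.
    by rewrite divr_ge0 ?mulr_ge0 ?powR_ge0.
  have HG : `|u x| `^ alpha * `|v x| `^ beta / enorm x `^ s <= Gu x + Gv x.
    rewrite /Gu /Gv -mulrDl ler_wpM2r ?invr_ge0 ?powR_ge0// -hab.
    exact: powRM_le_sum.
  rewrite /F -/(Gu x) -/(Gv x).
  set H := _ / _ in H0 HG *.
  rewrite (le_trans (ler_normD _ _))// (le_trans (lerD (ler_normD _ _) (lexx _)))//.
  rewrite (normrM lambda) (normrM mu) (normrM (p * kappa)).
  rewrite (ger0_norm (Gu0 x)) (ger0_norm (Gv0 x)) (ger0_norm H0).
  (* [K] is distributed over [Gu x + Gv x]: each of its first three terms dominates one summand of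
     [F], the mixed one through [HG]. *)
  rewrite /K !mulrDl mul1r -!addrA; apply: lerD.
    by rewrite ler_wpM2l// lerDl.
  apply: lerD; first by rewrite ler_wpM2l// lerDr.
  by rewrite ler_wpDr ?addr_ge0// ler_wpM2l.
have mu_u : measurable_fun Omega u by exact: D012_fun_measurable.
have mu_v : measurable_fun Omega v by exact: D012_fun_measurable.
have mF : measurable_fun Omega F.
  have mp (f : 'rV[R]_n.+3 -> R) q : measurable_fun Omega f ->
      measurable_fun Omega (fun x => `|f x| `^ q).
    by move=> mf; apply: (measurableT_comp (measurable_powR _)); exact: measurableT_comp.
  have mw : measurable_fun Omega (fun x : 'rV[R]_n.+3 => (enorm x `^ s)^-1).
    by apply: measurable_funTS; exact: measurable_enorm_powRV.
  apply: measurable_funD.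
    apply: measurable_funD; apply: measurable_funM => //;
      by apply: measurable_funM => //; exact: mp.
  apply: measurable_funM => //; apply: measurable_funM => //.
  by apply: measurable_funM; exact: mp.
have iF : nu.-integrable Omega (EFin \o F).
  apply: (le_integrable mO _ _ iK); first exact/measurable_EFinP.
  move=> x _ /=; rewrite lee_fin (le_trans (FK x))//.
  exact: ler_norm.
split => //.
set I := \int[nu]_(x in Omega) F x.
set U := \int[nu]_(x in Omega) Gu x.
set V := \int[nu]_(x in Omega) Gv x.
have U0 : 0 <= U by exact: Rintegral_ge0.
have V0 : 0 <= V by exact: Rintegral_ge0.
(* Both [0] and [I] lie below the bound, so the truncation at 0 costs nothing. *)
have IUV : Num.max 0 I <= K * (U + V).
  rewrite ge_max (mulr_ge0 (ltW K0) (addr_ge0 U0 V0)) /=.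
  rewrite /U /V -RintegralD// -RintegralZl//; last first.
    apply: (eq_integrable mO (fun x => (EFin \o Gu) x + (EFin \o Gv) x)%E) => //.
    exact: integrableD.
  by apply: le_Rintegral => // x _; exact: le_trans (ler_norm _) (FK x).
have hu := D012_hardy_sobolev oO u hs C0_gt0 HC.
have hv := D012_hardy_sobolev oO v hs C0_gt0 HC.
rewrite -/p -/U in hu; rewrite -/p -/V in hv.
rewrite mulrC ler_pdivrMr//.
have m0 : 0 <= Num.max 0 I by rewrite le_max lexx.
apply: (le_trans (ge0_ler_powR r0 m0 _ IUV)).
  exact: mulr_ge0 (ltW K0) (addr_ge0 U0 V0).
rewrite (powRM _ (ltW K0) (addr_ge0 U0 V0)) [leRHS]mulrC /M -mulrA ler_wpM2l ?powR_ge0//.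
rewrite (le_trans (powRD_le U0 V0 r0))// -mulrA ler_wpM2l ?powR_ge0//.
by rewrite (le_trans (lerD hu hv))// -!mulrDr mulrA.
Qed.
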